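(* Let $k$ be a field, $n\ge3$ and $d\ge2$ integers, $S=k[x_1,\ldots,x_n]$. Let $u=x_1^{a_1}\cdots x_n^{a_n}$ and $v=x_1^{b_1}\cdots x_n^{b_n}$, with $a_1>b_1\ge0$, be monomials of degree $d$, and let $I=(\mathcal L(u,v))\subset S$ be the lexsegment ideal defined by $u$ and $v$. Assume that $\dim(S/I)\ge1$. Then $I$ is Cohen--Macaulay if and only if one of the following conditions is fulfilled: (a) $u=x_1x_n^{d-1}$ and $v=x_2^d$; (b) $v=x_{n-1}^ax_n^{d-a}$ for some $a>0$ and $x_nu/x_1<_{lex}v$.
   Context: Lexicographic order is taken with $x_1>\cdots>x_n$. $\mathcal L(u,v)$ is the set of all monomials $w$ of degree $d$ of $S$ with $u\ge_{lex}w\ge_{lex}v$, and $(\mathcal L(u,v))$ is the ideal it generates. The ideal $I$ is called Cohen--Macaulay if $S/I$ is a Cohen--Macaulay $S$-module, i.e. $\mathrm{depth}(S/I)=\dim(S/I)$ (depth with respect to $(x_1,\ldots,x_n)$). *)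

(* Defs.v *)
From HB Require Import structures.
From mathcomp Require Import all_boot all_order all_algebra.
From mathcomp Require Import ring_quotient generic_quotient boolp.
From mathcomp Require Export mpoly.

Set Implicit Arguments.
Unset Strict Implicit.
Unset Printing Implicit Defensive.

Import Order.TTheory GRing.Theory.
Local Open Scope ring_scope.
Local Open Scope quotient_scope.

(* Possibly improper ideals; the library's [idealr] is proper by definition. *)
HB.mixin Record isMulAbsorbing (R : comNzRingType) (I : R -> bool) := {
  ringIdealMr : forall a, {in I, forall x, a * x \in I}
}.

#[short(type="ringIdeal")]
HB.structure Definition RingIdeal (R : comNzRingType) :=
  {I of GRing.ZmodClosed R I & isMulAbsorbing R I}.

Section IdealGen.
Variables (R : comNzRingType) (G : R -> Prop).

Definition ideal_gen : {pred R} := fun f =>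
  `[< exists2 s : seq (R * R),
        (forall p, p \in s -> G p.2) & f = \sum_(p <- s) p.1 * p.2 >].

Fact ideal_genMr a : {in ideal_gen, forall f, a * f \in ideal_gen}.
Proof.
move=> f /asboolP[s sG ->]; apply/asboolP.
exists [seq (a * p.1, p.2) | p <- s] => [p /mapP[q /sG qG ->] //|].
by rewrite big_map mulr_sumr; apply: eq_bigr => p _; rewrite mulrA.
Qed.

Fact ideal_gen_zmod_closed : zmod_closed ideal_gen.
Proof.
split; first by apply/asboolP; exists [::] => //; rewrite big_nil.
move=> f g fI /(ideal_genMr (-1)); rewrite mulN1r.
case/asboolP: fI => s sG -> /asboolP[t tG ->]; apply/asboolP.
exists (s ++ t) => [p|]; last by rewrite big_cat.
by rewrite mem_cat => /orP[/sG|/tG].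
Qed.

HB.instance Definition _ :=
  GRing.isZmodClosed.Build R ideal_gen ideal_gen_zmod_closed.
HB.instance Definition _ := isMulAbsorbing.Build R ideal_gen ideal_genMr.

End IdealGen.

(* R/I, carrying both its ring structure and its R-module structure. It is an
   alias of the library's additive quotient, because the library only turns
   quotients by proper ideals into rings. *)
Definition quot_alg (R : comNzRingType) (I : ringIdeal R) : Type :=
  {ideal_quot I}.

Section QuotAlg.
Variables (R : comNzRingType) (I : ringIdeal R).
Local Notation Q := (quot_alg I).

HB.instance Definition _ := GRing.Zmodule.copy Q {ideal_quot I}.

Definition quot_alg_pi (x : R) : Q := \pi_{ideal_quot I} x.
Definition quot_alg_repr (x : Q) : R := repr (x : {ideal_quot I}).

Local Notation pi := quot_alg_pi.
Local Notation rep := quot_alg_repr.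

Lemma quot_alg_reprK x : pi (rep x) = x. Proof. exact: reprK. Qed.
Lemma quot_alg_piD x y : pi (x + y) = pi x + pi y.
Proof. exact: (raddfD (\pi_{ideal_quot I})). Qed.
Lemma quot_alg_pi_eq x y : (pi x == pi y) = (x - y \in I).
Proof. by rewrite Quotient.idealrBE. Qed.
Local Lemma pi_rep x : x - rep (pi x) \in I.
Proof. by rewrite Quotient.idealrBE; apply/eqP/esym/reprK. Qed.

Definition quot_alg_scale (a : R) (x : Q) : Q := pi (a * rep x).
Definition quot_alg_mul (x y : Q) : Q := pi (rep x * rep y).

Lemma quot_alg_pi_scale a x : quot_alg_scale a (pi x) = pi (a * x).
Proof.
apply/esym/eqP; rewrite quot_alg_pi_eq -mulrBr.
exact/ringIdealMr/pi_rep.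
Qed.
Lemma quot_alg_pi_mul x y : quot_alg_mul (pi x) (pi y) = pi (x * y).
Proof.
rewrite -[LHS]/(quot_alg_scale (rep (pi x)) (pi y)) quot_alg_pi_scale.
rewrite mulrC [x * y]mulrC -!quot_alg_pi_scale.
by congr quot_alg_scale; apply: quot_alg_reprK.
Qed.

Fact quot_alg_scaleA a b (x : Q) :
  quot_alg_scale a (quot_alg_scale b x) = quot_alg_scale (a * b) x.
Proof. by rewrite -[x]quot_alg_reprK !quot_alg_pi_scale mulrA. Qed.
Fact quot_alg_scale1 : left_id 1 quot_alg_scale.
Proof. by move=> x; rewrite -[x]quot_alg_reprK quot_alg_pi_scale mul1r. Qed.
Fact quot_alg_scaleDr : right_distributive quot_alg_scale +%R.
Proof.
by move=> a x y; rewrite -[x]quot_alg_reprK -[y]quot_alg_reprK -quot_alg_piD !quot_alg_pi_scale -quot_alg_piD mulrDr.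
Qed.
Fact quot_alg_scaleDl (x : Q) : {morph quot_alg_scale^~ x : a b / a + b}.
Proof. by move=> a b; rewrite -[x]quot_alg_reprK !quot_alg_pi_scale -quot_alg_piD mulrDl. Qed.

HB.instance Definition _ := GRing.Zmodule_isLmodule.Build R Q
  quot_alg_scaleA quot_alg_scale1 quot_alg_scaleDr quot_alg_scaleDl.

Fact quot_alg_mulA : associative quot_alg_mul.
Proof.
by move=> x y z; rewrite -[x]quot_alg_reprK -[y]quot_alg_reprK -[z]quot_alg_reprK !quot_alg_pi_mul mulrA.
Qed.
Fact quot_alg_mulC : commutative quot_alg_mul.
Proof. by move=> x y; rewrite -[x]quot_alg_reprK -[y]quot_alg_reprK !quot_alg_pi_mul mulrC. Qed.
Fact quot_alg_mul1 : left_id (pi 1) quot_alg_mul.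
Proof. by move=> x; rewrite -[x]quot_alg_reprK !quot_alg_pi_mul mul1r. Qed.
Fact quot_alg_mulDl : left_distributive quot_alg_mul +%R.
Proof.
move=> x y z; rewrite -[x]quot_alg_reprK -[y]quot_alg_reprK -[z]quot_alg_reprK -quot_alg_piD !quot_alg_pi_mul -quot_alg_piD.
by rewrite mulrDl.
Qed.

HB.instance Definition _ := GRing.Zmodule_isComPzRing.Build Q
  quot_alg_mulA quot_alg_mulC quot_alg_mul1 quot_alg_mulDl.

End QuotAlg.

(* r is the largest natural number with property P. *)
Definition is_greatest (P : nat -> Prop) (r : nat) : Prop :=
  P r /\ forall s, P s -> (s <= r)%N.

Section KrullDimension.
Variable A : comPzRingType.

Definition prime_ideal (P : A -> Prop) : Prop :=
  [/\ P 0, forall x y, P x -> P y -> P (x + y),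
      forall a x, P x -> P (a * x), ~ P 1
    & forall x y, P (x * y) -> P x \/ P y].

(* There is a strictly increasing chain P_0 < ... < P_r of prime ideals. *)
Definition prime_chain (r : nat) : Prop :=
  exists P : nat -> A -> Prop,
    (forall i, (i <= r)%N -> prime_ideal (P i)) /\
    (forall i, (i < r)%N ->
       (forall x, P i x -> P i.+1 x) /\ (exists x, P i.+1 x /\ ~ P i x)).

Definition krull_dim_ge (r : nat) : Prop :=
  exists2 s, (r <= s)%N & prime_chain s.

Definition krull_dim_is (r : nat) : Prop := is_greatest prime_chain r.

End KrullDimension.

Section Depth.
Variables (R : comNzRingType) (M : lmodType R).

(* m lies in (s_0, ..., s_(i-1)) M. *)
Definition in_seq_submod (s : seq R) (i : nat) (m : M) : Prop :=
  exists c : nat -> M, m = \sum_(0 <= j < i) s`_j *: c j.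

(* s_i is a nonzerodivisor on M / (s_0, ..., s_(i-1)) M for every i, and
   (s) M <> M. *)
Definition regular_seq (s : seq R) : Prop :=
  (forall i, (i < size s)%N -> forall m : M,
     in_seq_submod s i (s`_i *: m) -> in_seq_submod s i m) /\
  (exists m : M, ~ in_seq_submod s (size s) m).

Definition regular_seq_length (J : {pred R}) (r : nat) : Prop :=
  exists s : seq R, [/\ size s = r, {subset s <= J} & regular_seq s].

Definition depth_is (J : {pred R}) (r : nat) : Prop :=
  is_greatest (regular_seq_length J) r.

End Depth.

Section Monomials.
Variable n : nat.

(* 'X_{1..n} is the type of exponent vectors. Variables are numbered from 1 as
   x_1, ..., x_n; [mon_var j] is the monomial x_j, for 1 <= j <= n. *)
Definition mon_var (j : nat) : 'X_{1..n} :=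
  [multinom (i.+1 == j : nat) | i < n].

(* The exponent of x_j in m, for 1 <= j <= n. *)
Definition mon_exp (m : 'X_{1..n}) (j : nat) : nat := nth 0%N m j.-1.

(* Pure lexicographic order with x_1 > ... > x_n; the library's order on
   'X_{1..n} compares total degrees first. *)
Definition lex_le (m1 m2 : 'X_{1..n}) : bool :=
  ((m1 : n.-tuplelexi nat) <= (m2 : n.-tuplelexi nat))%O.
Definition lex_lt (m1 m2 : 'X_{1..n}) : bool :=
  ((m1 : n.-tuplelexi nat) < (m2 : n.-tuplelexi nat))%O.

Definition lexsegment (d : nat) (u v : 'X_{1..n}) : pred 'X_{1..n} :=
  fun w => [&& mdeg w == d, lex_le w u & lex_le v w].

End Monomials.

Section PolynomialIdeals.
Variables (k : fieldType) (n : nat).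
Local Notation S := {mpoly k[n]}.

Definition lexsegment_ideal (d : nat) (u v : 'X_{1..n}) : ringIdeal S :=
  @ideal_gen S (fun f => exists2 w, lexsegment d u v w & f = 'X_[w]).

Definition irrelevant_ideal : ringIdeal S :=
  @ideal_gen S (fun f => exists i : 'I_n, f = 'X_i).

Definition cohen_macaulay_ideal (I : ringIdeal S) : Prop :=
  exists r, depth_is (quot_alg I) irrelevant_ideal r /\
            krull_dim_is (quot_alg I) r.

End PolynomialIdeals.

(* Main.v *)
(** The dimension bounds and depth bounds all rest on one counting fact: modulo
    the ideal of the variables in V, any r > n - |V| polynomials y_1, ..., y_r
    are algebraically dependent, and factoring out the lexicographically least
    monomial of a relation gives y_1^e1 (y_2^e2 (... (y_r^er (1 + a_r y_r)) ...)
    + a_1 y_1) in (x_i : i in V).  Along a chain of primes starting above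
    (x_i : i in V) such an element forces 1 into the last prime, so chains have
    length at most n - |V|.  If the x_i with i in V kill a class z <> 0 in S/I and
    the y_i form a regular sequence, it forces z into (y_1, ..., y_r) S/I;
    applied to high powers of the y_i this contradicts degree reasons, so
    depth S/I <= n - |V|.

    With b = b_1, e = d - b - 1: if v <= x_n u / x_1, then u / x_1 lies in the
    socle of S/I.  Otherwise a_1 = b + 1, and one of the monomials x_1^b x_2^e,
    x_1^b x_2^e x_n^e, x_1 x_n^(d-2), x_1 x_2^(d-1) x_n^(d-2) is killed by
    enough variables to bound the depth below the dimension, except in the two
    listed cases.  There x_1 + x_n, preceded by x_3, ..., x_(n-1) in case (a), is a
    maximal regular sequence. *)

Require Import Defs.
From mathcomp Require Import all_boot all_order all_algebra.
From mathcomp Require Import boolp zify.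

Set Implicit Arguments.
Unset Strict Implicit.
Unset Printing Implicit Defensive.

Import Order.TTheory GRing.Theory.
Local Open Scope ring_scope.

(** * Regular sequences modulo a submodule *)

Section RegularSequences.
Variables (R : comNzRingType) (M : lmodType R).
Implicit Types (N : M -> Prop) (a b y : R) (l : seq R) (m z : M).

Definition is_submod N : Prop :=
  [/\ N 0, forall m z, N m -> N z -> N (m + z) & forall a m, N m -> N (a *: m)].

(** This is the submodule [N] + yM. Folding it over a list adjoins the generators one at a time,
    which allows induction from either end. *)
Definition adjoin N y : M -> Prop := fun m => exists z, N (m - y *: z).

(* [l] is a (possibly improper) regular sequence on the quotient of [M] by the
   submodule [N]. *)
Fixpoint wreg N l : Prop :=
  if l is y :: l' then
    (forall m, N (y *: m) -> N m) /\ wreg (adjoin N y) l'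
  else True.

Lemma submodB N m z : is_submod N -> N m -> N z -> N (m - z).
Proof. by case=> _ ND NZ Nm Nz; rewrite -scaleN1r; apply: ND => //; apply: NZ. Qed.

Lemma adjoin_submod N y : is_submod N -> is_submod (adjoin N y).
Proof.
case=> N0 ND NZ; split.
- by exists 0; rewrite scaler0 subr0.
- move=> m z [m' Nm] [z' Nz]; exists (m' + z').
  by rewrite scalerDr opprD addrACA; apply: ND.
- move=> a m [m' Nm]; exists (a *: m').
  by rewrite scalerA mulrC -scalerA -scalerBr; apply: NZ.
Qed.

Lemma foldl_adjoin_submod N l : is_submod N -> is_submod (foldl adjoin N l).
Proof. by elim: l N => //= y l IH N Nsub; apply/IH/adjoin_submod. Qed.

Lemma adjoin_incl N N' y : (forall m, N m -> N' m) ->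
  forall m, adjoin N y m -> adjoin N' y m.
Proof. by move=> NN' m [z /NN' ?]; exists z. Qed.

Lemma foldl_adjoin_incl N N' l : (forall m, N m -> N' m) ->
  forall m, foldl adjoin N l m -> foldl adjoin N' l m.
Proof. by elim: l N N' => //= y l IH N N' NN'; apply/IH/adjoin_incl. Qed.

Lemma foldl_adjoinP N l m :
  foldl adjoin N l m <->
  exists c : nat -> M, N (m - \sum_(0 <= j < size l) l`_j *: c j).
Proof.
elim: l N m => [|y l IH] N m /=.
  split=> [Nm|[c]]; last by rewrite big_geq // subr0.
  by exists (fun=> 0); rewrite big_geq // subr0.
rewrite IH; split=> [[c [z Nz]]|[c Nc]].
  exists (fun j => if j is j'.+1 then c j' else z).
  by rewrite big_nat_recl //= opprD addrA addrAC.
exists (c \o succn), (c 0%N).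
by move: Nc; rewrite big_nat_recl //= opprD addrA addrAC.
Qed.

Lemma in_seq_submodP l i m : (i <= size l)%N ->
  in_seq_submod l i m <-> foldl adjoin (eq^~ 0) (take i l) m.
Proof.
move=> le_i; rewrite foldl_adjoinP /in_seq_submod size_takel //.
have sumE (c : nat -> M) :
    \sum_(0 <= j < i) (take i l)`_j *: c j = \sum_(0 <= j < i) l`_j *: c j.
  by apply: eq_big_nat => j /andP[_ ltji]; rewrite nth_take.
split=> -[c Hc]; exists c; first by rewrite sumE Hc subrr.
by move/eqP: Hc; rewrite subr_eq0 sumE => /eqP.
Qed.

Lemma wreg_cat N l1 l2 :
  wreg N (l1 ++ l2) <-> wreg N l1 /\ wreg (foldl adjoin N l1) l2.
Proof. by elim: l1 N => [|y l1 IH] N /=; [|rewrite IH]; tauto. Qed.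

Lemma foldl_adjoin_sub N l m : N m -> foldl adjoin N l m.
Proof.
move=> Nm; apply/foldl_adjoinP; exists (fun=> 0).
by rewrite big1 ?subr0 // => *; rewrite scaler0.
Qed.

Lemma wregP N l :
  wreg N l <-> (forall i, (i < size l)%N -> forall m,
    foldl adjoin N (take i l) (l`_i *: m) -> foldl adjoin N (take i l) m).
Proof.
elim: l N => [|y l IH] N /=; first by split.
rewrite IH; split=> [[regy regl] [|i]|reg] //=; first exact: regl.
by split=> [|i ltil]; [apply: (reg 0%N) | apply: (reg i.+1)].
Qed.

Lemma regular_seqP l :
  regular_seq M l <->
  wreg (eq^~ 0) l /\ exists m, ~ foldl adjoin (eq^~ 0) l m.
Proof.
rewrite wregP /regular_seq.
have E i m : (i <= size l)%N ->
  in_seq_submod l i m <-> foldl adjoin (eq^~ 0) (take i l) m := @in_seq_submodP l i m.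
split=> -[reg [m Nm]]; split.
- by move=> i lti z; rewrite -!E ?(ltnW lti) //; apply: reg.
- by exists m; move: Nm; rewrite E // take_size.
- by move=> i lti z; rewrite !E ?(ltnW lti) //; apply: reg.
- by exists m; rewrite E // take_size.
Qed.

(* Injectivity of the multiplication by [a] from M/bM to M/abM survives modulo
   a sequence that is regular on M/aM. *)
Lemma foldl_adjoin_mul_cancel N a b l m : is_submod N ->
  (forall m, N (a *: m) -> N m) -> wreg (adjoin N a) l ->
  foldl adjoin (adjoin N (a * b)) l (a *: m) -> foldl adjoin (adjoin N b) l m.
Proof.
move=> Nsub rega; elim/last_ind: l m => [|l y IH] m /=.
  by move=> _ [z]; rewrite -scalerA -scalerBr => /rega ?; exists z.
rewrite -cats1 => /wreg_cat[/IH{}IH [regy _]].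
rewrite !foldl_cat /= => -[z Nz].
(* Modulo [a] the hypothesis says that [y] kills [z], so regularity of [y] after [a] and [l] makes
   [z] a multiple of [a] modulo [l]. *)
have [h Nh] : exists h, foldl adjoin N l (z - a *: h).
  have : foldl adjoin (adjoin N a) l z.
    apply: regy; rewrite -[y *: z](subKr (a *: m)).
    apply: submodB; first exact/foldl_adjoin_submod/adjoin_submod.
      by apply: foldl_adjoin_sub; exists m; rewrite subrr; case: Nsub.
    apply: foldl_adjoin_incl Nz => t [w Nw]; exists (b *: w).
    by rewrite scalerA.
  move=> /foldl_adjoinP[c [h Nh]]; exists h; apply/foldl_adjoinP; exists c.
  by rewrite addrAC.
exists h; apply: IH => //.
rewrite scalerBr scalerA [a * y]mulrC -scalerA.
have -> : a *: m - y *: (a *: h) = (a *: m - y *: z) + y *: (z - a *: h).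
  by rewrite scalerBr addrA subrK.
case: (foldl_adjoin_submod l (adjoin_submod (a * b) Nsub)) => _ + NZ'; apply => //.
apply: NZ'; apply: foldl_adjoin_incl Nh => t Nt.
by exists 0; rewrite scaler0 subr0.
Qed.

(** Let s follow [l'] in [l]. If s m lies in (ab, l')M, regularity after [a] gives m = a g modulo
    l'. Cancelling [a] puts s g in (b, l')M, regularity after [b] puts g there, and so m lies in
    (ab, l')M. *)
Lemma wreg_mul N a b l : is_submod N ->
  wreg N (a :: l) -> wreg N (b :: l) -> wreg N (a * b :: l).
Proof.
move=> Nsub [rega regal] [regb regbl]; split=> [m|].
  by rewrite -scalerA => /rega/regb.
apply/wregP => i lti m Nsm.
set l' := take i l in Nsm *; set s := l`_i in Nsm.
have regal' : wreg (adjoin N a) l'.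
  by move: regal; rewrite -{1}(cat_take_drop i l) => /wreg_cat[].
have Nab t : foldl adjoin (adjoin N (a * b)) l' t -> foldl adjoin (adjoin N a) l' t.
  by apply: foldl_adjoin_incl => {}t [w Nw]; exists (b *: w); rewrite scalerA.
have /foldl_adjoinP[c [g Ng]] : foldl adjoin (adjoin N a) l' m.
  by apply: ((wregP _ _).1 regal i lti); apply: Nab.
have {}Ng : foldl adjoin N l' (m - a *: g).
  by apply/foldl_adjoinP; exists c; rewrite addrAC.
have NN y t : foldl adjoin N l' t -> foldl adjoin (adjoin N y) l' t.
  by apply: foldl_adjoin_incl => {}t Nt; exists 0; rewrite scaler0 subr0.
have subN y : is_submod (foldl adjoin (adjoin N y) l').
  exact/foldl_adjoin_submod/adjoin_submod.
have : foldl adjoin (adjoin N b) l' g.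
  apply: ((wregP _ _).1 regbl i lti).
  apply: (foldl_adjoin_mul_cancel Nsub rega regal').
  have -> : a *: (s *: g) = s *: m - s *: (m - a *: g).
    by rewrite scalerBr subKr !scalerA mulrC.
  apply: submodB => //; case: (subN (a * b)) => _ _; apply; exact: NN.
move=> /foldl_adjoinP[c' [h Nh]].
rewrite -[m](subrK (a *: g)); case: (subN (a * b)) => _ + _; apply; first exact: NN.
apply/foldl_adjoinP; exists (fun j => a *: c' j), h.
rewrite -scalerA -[X in _ - X - _](_ : a *: (\sum_(0 <= j < size l') l'`_j *: c' j) = _).
  by rewrite -!scalerBr; case: Nsub => _ _; apply.
by rewrite scaler_sumr; apply: eq_bigr => j _; rewrite !scalerA mulrC.
Qed.

(** [wreg_mul] raises the head to a power with the tail fixed; the tail is then treated by induction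
    modulo that power. *)
Lemma wreg_exp N l e : is_submod N ->
  wreg N l -> wreg N [seq y ^+ e.+1 | y <- l].
Proof.
elim: l N => //= y l IH N Nsub [regy regl].
have : wreg N (y ^+ e.+1 :: l).
  by elim: e {IH} => [|e IHe]; rewrite ?expr1 // exprS; apply: wreg_mul.
by case=> ? ?; split=> //; apply: IH => //; apply: adjoin_submod.
Qed.

(* The values at [l] of the polynomials whose lexicographically least monomial
   has coefficient 1. *)
Fixpoint lex_unitary l (t : R) : Prop :=
  if l is y :: l' then
    exists e a t', lex_unitary l' t' /\ t = y ^+ e * (t' + a * y)
  else t = 1.

(** Regularity cancels the factor y^e, and [adjoin N y] absorbs the term a y, which leaves t' acting
    on [z] for the rest of the list. *)
Lemma wreg_lex_unitary N l t z : is_submod N ->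
  wreg N l -> lex_unitary l t -> N (t *: z) -> foldl adjoin N l z.
Proof.
elim: l N t => [|y l IH] N t Nsub /=; first by move=> _ ->; rewrite scale1r.
move=> [regy regl] [e [a [t' [ut' ->]]]] Nt.
apply: (IH _ t') => //; first exact: adjoin_submod.
have {}Nt : N ((t' + a * y) *: z).
  elim: e Nt => [|e IHe]; first by rewrite mul1r.
  by rewrite exprS -mulrA -scalerA => /regy.
by exists (- a *: z); rewrite scalerA mulrN scaleNr opprK -scalerDl [y * a]mulrC.
Qed.

End RegularSequences.

(** * Algebraic dependence modulo a set of variables *)

Section AlgebraicDependence.

Lemma lin_dep (K : fieldType) (E : eqType) (s : seq E) (T : finType)
    (A : {pred T}) (g : E -> T -> K) : uniq s -> (#|A| < size s)%N ->
  exists c : E -> K, (exists2 e, e \in s & c e != 0) /\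
    forall t, t \in A -> \sum_(e <- s) c e * g e t = 0.
Proof.
case: s => [|e0 s'] //; set s := e0 :: s' => us ltAs.
pose G := \matrix_(i < size s, j < #|A|) g (nth e0 s i) (enum_val j).
have : kermx G != 0.
  rewrite -mxrank_eq0 mxrank_ker subn_eq0 -ltnNge.
  exact: leq_ltn_trans (rank_leq_col G) ltAs.
case/rowV0Pn => v /sub_kermxP vG0 /rV0Pn[i vi].
exists (fun e => v 0 (inord (index e s))); split.
  exists (nth e0 s i); first by rewrite mem_nth.
  by rewrite index_uniq // inord_val.
move=> t tA; rewrite (big_nth e0) big_mkord.
have /rowP/(_ (enum_rank_in tA t)) := vG0; rewrite !mxE => /(etrans _); apply.
apply: eq_bigr => j _; rewrite !mxE enum_rankK_in //.
by rewrite [index _ _]index_uniq ?inord_val.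
Qed.

Fixpoint exponents (N r : nat) : seq (seq nat) :=
  if r is r'.+1 then [seq i :: e | i <- iota 0 N, e <- exponents N r']
  else [:: [::]].

Lemma size_exponents N r : size (exponents N r) = (N ^ r)%N.
Proof. by elim: r => //= r IH; rewrite size_allpairs size_iota IH expnS. Qed.

Lemma exponents_uniq N r : uniq (exponents N r).
Proof.
elim: r => //= r IH; apply: allpairs_uniq; rewrite ?iota_uniq //.
by move=> [i e] [j f] /= _ _ [-> ->].
Qed.

Variables (k : fieldType) (n : nat).
Local Notation S := {mpoly k[n]}.
Implicit Types (l : seq S) (y t : S) (e : seq nat).

Definition monomial_at l e : S := \prod_(p <- zip l e) p.1 ^+ p.2.

(** Let i0 be the least first exponent with a nonzero coefficient. The terms with first exponent i0
    give, by induction, y^i0 times a multiple of a unitary t; all later ones contain y^(i0+1) and go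
    into the summand a y. *)
Lemma lex_unitary_comb l N (c : seq nat -> k) :
  (exists2 e, e \in exponents N (size l) & c e != 0) ->
  exists lam t, [/\ lam != 0, lex_unitary l t &
    \sum_(e <- exponents N (size l)) c e *: monomial_at l e = lam *: t].
Proof.
elim: l c => [|y l IH] c /=.
  case=> e; rewrite inE => /eqP-> cn0; exists (c [::]), 1; split=> //.
  by rewrite big_seq1 /monomial_at /= big_nil.
case=> _ /allpairsP[[i e] /= [iN eN ->]] cn0.
pose P i := has (fun e => c (i :: e) != 0) (exponents N (size l)).
have exP : exists i, P i by exists i; apply/hasP; exists e.
case: (ex_minnP exP) => i0 /hasP[e0 e0N ce0] i0min.
have lti0 : (i0 < N)%N.
  apply: leq_ltn_trans (i0min i _) _; last by rewrite mem_iota in iN.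
  by apply/hasP; exists e.
have [|lam [t [lam0 ut sumE]]] := IH (fun e => c (i0 :: e)); first by exists e0.
pose B i := \sum_(e <- exponents N (size l)) c (i :: e) *: monomial_at l e.
pose C := \sum_(i0.+1 <= i < N) y ^+ (i - i0.+1) * B i.
exists lam, (y ^+ i0 * (t + (lam^-1 *: C) * y)); split=> //.
  by exists i0, (lam^-1 *: C), t.
rewrite big_allpairs_dep /=.
have -> : iota 0 N = index_iota 0 N by rewrite /index_iota subn0.
have sE i1 : \sum_(e1 <- exponents N (size l))
    c (i1 :: e1) *: monomial_at (y :: l) (i1 :: e1) = y ^+ i1 * B i1.
  rewrite mulr_sumr; apply: eq_bigr => e1 _.
  by rewrite /monomial_at /= big_cons /= scalerAr.
rewrite (eq_bigr _ (fun i1 _ => sE i1)) (big_cat_nat (n := i0)) ?(ltnW lti0) //=.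
rewrite big_nat big1 ?add0r => [|i1 /andP[_ lti1]]; last first.
  rewrite /B big_seq big1 ?mulr0 // => e1 e1N.
  have [->|ce1] := eqVneq (c (i1 :: e1)) 0; first by rewrite scale0r.
  have /i0min : P i1 by apply/hasP; exists e1.
  by rewrite leqNgt lti1.
rewrite big_ltn // [B i0]sumE.
have -> : \sum_(i0.+1 <= i1 < N) y ^+ i1 * B i1 = y ^+ i0 * (y * C).
  rewrite mulrA -exprSr mulr_sumr; apply: eq_big_nat => i1 /andP[lti _].
  by rewrite mulrA -exprD subnKC.
rewrite -mulrDr scalerAr; congr (_ * _).
by rewrite scalerDr -scalerAl scalerA mulfV // scale1r mulrC.
Qed.

Lemma msize_monomial_at l N D e : (forall y, y \in l -> msize y <= D.+1)%N ->
  e \in exponents N (size l) -> (msize (monomial_at l e) <= (size l * (N * D)).+1)%N.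
Proof.
elim: l e => [|y l IH] /= e lD.
  by rewrite inE => /eqP->; rewrite /monomial_at big_nil msize1.
case/allpairsP=> -[i e'] /= [iN e'N ->]; rewrite /monomial_at /= big_cons /=.
rewrite mem_iota in iN.
have le_mul (p q : S) a b : (msize p <= a.+1)%N -> (msize q <= b.+1)%N ->
    (msize (p * q) <= (a + b).+1)%N.
  have [->|p0] := eqVneq p 0; first by rewrite mul0r msize0.
  have [->|q0] := eqVneq q 0; first by rewrite mulr0 msize0.
  rewrite msizeM // => pa qb; rewrite -ltnS prednK ?addn_gt0 ?lt0n ?msize_poly_eq0 ?p0 //.
  by rewrite -addnS -addSn leq_add.
rewrite mulSn; apply: (le_mul _ _ _ _); last first.
  by apply: IH => // z zl; apply: lD; rewrite inE zl orbT.
have : (msize (y ^+ i) <= (i * D).+1)%N.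
  elim: i {iN} => [|i IHi]; first by rewrite expr0 msize1.
  by rewrite exprS mulSn; apply: (le_mul _ _ _ _) => //; apply: lD; rewrite mem_head.
move/leq_trans; apply; rewrite ltnS leq_mul2r; lia.
Qed.

Lemma lex_unitary_in_vars (V : {set 'I_n}) l : (#|~: V| < size l)%N ->
  exists2 t, lex_unitary l t &
    forall m, m \in msupp t -> exists2 i, i \in V & (0 < m i)%N.
Proof.
move=> ltVl; pose r := size l.
pose D := (\max_(y <- l) msize y)%N.
(* With q the size of the complement of [V], at most (B+1)^q <= (N(rD+1))^q monomials free of [V]
   have exponents at most [B]. As [N] exceeds (rD+1)^q, this is less than N^(q+1) <= N^r, the number
   of products available. *)
pose N := ((r * D).+1 ^ #|~: V|).+1.
pose B := (r * (N * D))%N.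
have lD y : y \in l -> (msize y <= D.+1)%N.
  by move=> yl; apply: leqW; rewrite /D (big_rem y) //= leq_maxl.
pose mon (f : {ffun 'I_n -> 'I_B.+1}) := [multinom (f i : nat) | i < n].
pose g e (f : {ffun 'I_n -> 'I_B.+1}) := (monomial_at l e)@_(mon f).
(* One equation for each exponent vector vanishing on [V], encoded as a function equal to 0 outside
   the complement of [V]. *)
have [|c [cn0 c0]] := @lin_dep k _ (exponents N r) _
    (pffun_on ord0 (~: V) predT) g (exponents_uniq N r).
  rewrite size_exponents card_pffun_on cardT size_enum_ord.
  have leB : (B.+1 <= N * (r * D).+1)%N by rewrite /B mulnCA mulnS; lia.
  apply: (@leq_ltn_trans (N ^ #|~: V| * (r * D).+1 ^ #|~: V|)).
    by case: #|~: V| leB => [|q] // leB; rewrite -expnMn leq_exp2r.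
  apply: leq_trans (_ : N ^ #|~: V|.+1 <= _)%N; last by rewrite leq_exp2l // ltnS expn_gt0.
  by rewrite expnSr ltn_pmul2l ?expn_gt0.
have [lam [t [lam0 ut sumE]]] := lex_unitary_comb cn0.
exists t => // m mt; apply: contrapT => noV.
have mV i : i \in V -> m i = 0%N.
  by move=> iV; apply/eqP; rewrite -leqn0 leqNgt; apply/negP => ?; apply: noV; exists i.
have : (lam *: t)@_m != 0 by rewrite mcoeffZ mulf_neq0 // -mcoeff_msupp.
case/eqP; rewrite -sumE raddf_sum /=.
(* The equations cover degrees up to [B]; above that no product has a term. *)
have [leB|ltB] := leqP (mdeg m) B; last first.
  rewrite big_seq big1 // => e eN; rewrite mcoeffZ.
  rewrite (memN_msupp_eq0 (msize_mdeg_ge _)) ?mulr0 //.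
  exact: leq_trans (msize_monomial_at lD eN) ltB.
have lemB i : (m i < B.+1)%N.
  by rewrite ltnS (leq_trans _ leB) // mdegE (bigD1 i) //= leq_addr.
pose f := [ffun i => inord (m i) : 'I_B.+1].
have monf : mon f = m by apply/mnmP => i; rewrite mnmE ffunE inordK.
rewrite -[RHS](c0 f); last first.
  apply/pffun_onP; split=> //; apply/subsetP => i; rewrite !inE ffunE.
  apply: contraNN => iV; apply/eqP/val_inj; rewrite /= inordK //; exact: mV.
by apply: eq_bigr => e _; rewrite mcoeffZ /g monf.
Qed.

End AlgebraicDependence.

(** * The projection onto the quotient ring *)

Section QuotAlgPi.
Variables (R : comNzRingType) (I : ringIdeal R).
Local Notation pi := (@quot_alg_pi R I).

Lemma quot_alg_pi0 : pi 0 = 0.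
Proof. by apply: (addrI (pi 0)); rewrite -quot_alg_piD !addr0. Qed.

Lemma quot_alg_pi_eq0 f : pi f = 0 <-> f \in I.
Proof.
rewrite -quot_alg_pi0; split=> [/eqP|fI]; last apply/eqP.
  by rewrite quot_alg_pi_eq subr0.
by rewrite quot_alg_pi_eq subr0.
Qed.

Lemma quot_alg_piZ a f : a *: pi f = pi (a * f).
Proof. exact: quot_alg_pi_scale. Qed.

Lemma quot_alg_piM f g : pi (f * g) = pi f * pi g.
Proof. exact/esym/quot_alg_pi_mul. Qed.

Lemma quot_alg_piN f : pi (- f) = - pi f.
Proof.
by apply: (addrI (pi f)); rewrite -quot_alg_piD !subrr quot_alg_pi0.
Qed.

Lemma quot_alg_piB f g : pi (f - g) = pi f - pi g.
Proof. by rewrite quot_alg_piD quot_alg_piN. Qed.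

Lemma quot_alg_pi_sum (T : Type) (r : seq T) (F : T -> R) :
  pi (\sum_(i <- r) F i) = \sum_(i <- r) pi (F i).
Proof.
by elim: r => [|i r IH]; rewrite ?big_nil ?quot_alg_pi0 // !big_cons quot_alg_piD IH.
Qed.

End QuotAlgPi.

Lemma trivial_submod (R : comNzRingType) (M : lmodType R) : is_submod (eq^~ (0 : M)).
Proof. by split=> [|m z -> ->|a m ->]; rewrite ?addr0 ?scaler0. Qed.

(** * Dimension and depth bounds for quotients of a polynomial ring *)

Section PolynomialQuotients.
Variables (k : fieldType) (n : nat).
Local Notation S := {mpoly k[n]}.
Implicit Types (f g : S) (V : {set 'I_n}) (m : 'X_{1..n}).

Lemma prime_ideal_exp (A : comPzRingType) (P : A -> Prop) x e :
  prime_ideal P -> P (x ^+ e) -> P x.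
Proof.
case=> _ _ _ P1 PM; elim: e => [/P1 //|e IH].
by rewrite exprS => /PM[].
Qed.

Lemma prime_ideal_varXn (I : ringIdeal S) P i e : prime_ideal P ->
  P (quot_alg_pi I 'X_[U_(i) *+ e]) -> P (quot_alg_pi I 'X_i).
Proof.
move=> primeP Pe; apply: (prime_ideal_exp (e := e)) => //.
suff <- : quot_alg_pi I 'X_[U_(i) *+ e] = quot_alg_pi I 'X_i ^+ e by [].
elim: e {Pe} => [|e IH]; first by rewrite mulm0n mpolyX0.
by rewrite mulmS mpolyXD quot_alg_piM IH exprS.
Qed.

Lemma mpoly_closed_ind (Q : S -> Prop) f :
  Q 0 -> (forall g h, Q g -> Q h -> Q (g + h)) ->
  (forall m, m \in msupp f -> Q (f@_m *: 'X_[m])) -> Q f.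
Proof.
move=> Q0 QD Qm; rewrite [f]mpolyE big_seq.
by apply: (big_ind Q) => // m /Qm.
Qed.

(** [Q] stands for any set closed like an ideal, so that one lemma serves both preimages of primes
    and annihilators of a class. *)
Lemma vars_ideal_sub (Q : S -> Prop) V f :
  Q 0 -> (forall g h, Q g -> Q h -> Q (g + h)) -> (forall g h, Q h -> Q (g * h)) ->
  (forall i, i \in V -> Q 'X_i) ->
  (forall m, m \in msupp f -> exists2 i, i \in V & (0 < m i)%N) -> Q f.
Proof.
move=> Q0 QD QM QV fV; apply: mpoly_closed_ind => // m /fV[i iV mi].
rewrite -(submK (m := U_(i)) (m' := m)) ?mpolyXD ?scalerAl; first exact/QM/QV.
by apply/mnm_lepP => j; rewrite mnm1E; case: eqP => [<-|].
Qed.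

Lemma krull_dim_le (I : ringIdeal S) t r :
  (forall P, prime_ideal P -> exists2 V,
     (#|~: V| <= t)%N & forall i, i \in V -> P (quot_alg_pi I 'X_i)) ->
  prime_chain (quot_alg I) r -> (r <= t)%N.
Proof.
move=> PV [P [primeP incP]]; rewrite leqNgt; apply/negP => lttr.
have /choice[y yP] : forall i, exists y : S, (i < r)%N ->
    P i.+1 (quot_alg_pi I y) /\ ~ P i (quot_alg_pi I y).
  move=> i; have [/incP[_ [x Px]]|_] := boolP (i < r)%N; last by exists 0.
  by exists (quot_alg_repr x); rewrite quot_alg_reprK.
have [V leV P0V] := PV _ (primeP 0%N isT).
have [|t0 ut t0V] := @lex_unitary_in_vars k n V (map y (iota 0 r)).
  by rewrite size_map size_iota (leq_ltn_trans leV).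
have P0t : P 0%N (quot_alg_pi I t0).
  have [P0 PD PM _ _] := primeP 0%N isT.
  apply: (@vars_ideal_sub (fun g => P 0%N (quot_alg_pi I g))) t0V => // [|g h|g h].
  - by rewrite quot_alg_pi0.
  - by rewrite quot_alg_piD; apply: PD.
  - by rewrite quot_alg_piM; apply: PM.
(* Climbing from P_j to P_(j+1): [y j] is outside P_j, so its power cancels there, and inside
   P_(j+1), so the term a (y j) drops. At the end 1 lies in P_r. *)
suff : forall s j f, (j + s <= r)%N -> lex_unitary (map y (iota j s)) f ->
    P j (quot_alg_pi I f) -> P (j + s)%N 1.
  move/(_ r 0%N t0 (leqnn _) ut P0t).
  by have [_ _ _ + _] := primeP r (leqnn r).
elim=> [|s IH] j f /= le_r; first by move=> ->; rewrite addn0.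
move=> [e [a [t' [ut' ->]]]].
have ltjr : (j < r)%N by lia.
have [yP1 yP0] := yP j ltjr.
have [_ _ _ P1 Pprime] := primeP j (ltnW ltjr).
have [_ PD PM _ _] := primeP j.+1 ltjr.
have [Psub _] := incP j ltjr.
move=> Pt; have : P j (quot_alg_pi I (t' + a * y j)).
  elim: e Pt => [|e IHe]; first by rewrite mul1r.
  by rewrite exprS -mulrA [quot_alg_pi I _]quot_alg_piM => /Pprime[].
move/Psub => Pt'; rewrite -addSnnS; apply: IH ut' _; first by lia.
rewrite -[t'](addrK (a * y j)) quot_alg_piB -mulN1r; apply: PD => //.
by apply/PM; rewrite quot_alg_piM; apply/PM.
Qed.

Definition kill_vars (q : nat) : S -> S :=
  comp_mpoly [tuple if (i < q)%N then 0 else 'X_i | i < n].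

Lemma kill_vars0 q : kill_vars q 0 = 0. Proof. exact: raddf0. Qed.
Lemma kill_varsD q f g : kill_vars q (f + g) = kill_vars q f + kill_vars q g.
Proof. exact: raddfD. Qed.
Lemma kill_varsM q f g : kill_vars q (f * g) = kill_vars q f * kill_vars q g.
Proof. exact: rmorphM. Qed.
Lemma kill_varsZ q a f : kill_vars q (a *: f) = a *: kill_vars q f.
Proof. exact: linearZ. Qed.

Lemma kill_varsX q m :
  kill_vars q 'X_[m] = \prod_(i < n) (if (i < q)%N then 0 else 'X_i) ^+ m i.
Proof.
by rewrite /kill_vars comp_mpolyX; apply: eq_bigr => i _; rewrite tnth_mktuple.
Qed.

Lemma kill_varsXU q i : kill_vars q 'X_i = if (i < q)%N then 0 else 'X_i.
Proof. by rewrite /kill_vars comp_mpolyXU -tnth_nth tnth_mktuple. Qed.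

Lemma kill_vars_comp q f : kill_vars q.+1 (kill_vars q f) = kill_vars q.+1 f.
Proof.
apply: (@mpoly_closed_ind (fun f => kill_vars q.+1 (kill_vars q f) = kill_vars q.+1 f)).
- by rewrite !kill_vars0.
- by move=> g h; rewrite !kill_varsD => -> ->.
move=> m _; rewrite !kill_varsZ; congr (_ *: _).
rewrite !kill_varsX [LHS]rmorph_prod; apply: eq_bigr => i _.
rewrite rmorphXn /=; congr (_ ^+ _); rewrite -[LHS]/(kill_vars q.+1 _).
have [ltiq|leqi] := ltnP i q; first by rewrite kill_vars0 leqW.
exact: kill_varsXU.
Qed.

Lemma prime_chain_vars (I : ringIdeal S) q : (q <= n)%N ->
  (forall f, f \in I -> kill_vars q f = 0) -> prime_chain (quot_alg I) (n - q).
Proof.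
move=> leqn killI.
(* The primes are the images of (x_1, ..., x_(q+j)), the kernels of setting these variables to
   zero. *)
pose P j (x : quot_alg I) := kill_vars (q + j) (quot_alg_repr x) = 0.
have killI' j f : f \in I -> kill_vars (q + j) f = 0.
  move=> fI; elim: j => [|j IH]; first by rewrite addn0 killI.
  by rewrite addnS -kill_vars_comp IH kill_vars0.
have Ppi j f : P j (quot_alg_pi I f) <-> kill_vars (q + j) f = 0.
  rewrite /P -[f in X in _ <-> X](subrK (quot_alg_repr (quot_alg_pi I f))).
  rewrite kill_varsD [X in _ <-> X + _ = 0]killI' ?add0r //.
  by rewrite -quot_alg_pi_eq quot_alg_reprK.
exists P; split=> [j lej|j ltj].
  split.
  - by rewrite -(quot_alg_pi0 I) Ppi kill_vars0.
  - move=> x y; rewrite -[x]quot_alg_reprK -[y]quot_alg_reprK -quot_alg_piD !Ppi.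
    by rewrite kill_varsD => -> ->; rewrite addr0.
  - move=> a x; rewrite -[x]quot_alg_reprK -[a]quot_alg_reprK -quot_alg_piM !Ppi.
    by rewrite kill_varsM => ->; rewrite mulr0.
  - rewrite -[1]/(quot_alg_pi I 1) Ppi [kill_vars _ _]rmorph1 => /eqP.
    by rewrite oner_eq0.
  - move=> x y; rewrite -[x]quot_alg_reprK -[y]quot_alg_reprK -quot_alg_piM !Ppi.
    rewrite kill_varsM => /eqP; rewrite mulf_eq0.
    by case/orP=> /eqP; [left|right].
split=> [x|].
  by rewrite -[x]quot_alg_reprK !Ppi addnS -kill_vars_comp => ->; rewrite kill_vars0.
have ltqj : (q + j < n)%N by lia.
exists (quot_alg_pi I 'X_(Ordinal ltqj)); rewrite !Ppi !kill_varsXU /= addnS ltnSn ltnn.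
split=> // /(congr1 (mcoeff U_(Ordinal ltqj))) /eqP.
by rewrite mcoeffX eqxx mcoeff0 oner_eq0.
Qed.

Definition order_ge (e : nat) f := forall m, m \in msupp f -> (e <= mdeg m)%N.

Lemma order_geM e1 e2 f g : order_ge e1 f -> order_ge e2 g -> order_ge (e1 + e2) (f * g).
Proof.
move=> of1 og m /msuppM_le/allpairsP[[m1 m2] /= [/of1 ? /og ? ->]].
by rewrite mdegD leq_add.
Qed.

Lemma irrelevant_order_ge f : f \in irrelevant_ideal k n -> order_ge 1 f.
Proof.
case/asboolP=> s sX ->; move: sX.
elim: s => [|p s IH] sX m; first by rewrite big_nil msupp0.
rewrite big_cons => /msuppD_le; rewrite mem_cat => /orP[|]; last first.
  by apply: IH => q qs; apply: sX; rewrite inE qs orbT.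
have [i ->] := sX p (mem_head _ _).
by rewrite (perm_mem (msuppMX _ _)) => /mapP[m' _ ->]; rewrite mdegD mdeg1.
Qed.

(** Multiples of elements of [l] only have monomials of degree above [mdeg m], and [I] contributes
    nothing at [m], so the coefficient 1 at [m] cannot arise. *)
Lemma foldl_adjoin_order (I : ringIdeal S) (l : seq S) m :
  (forall g, g \in I -> g@_m = 0) ->
  (forall g, g \in l -> order_ge (mdeg m).+1 g) ->
  ~ foldl (@adjoin S (quot_alg I)) (eq^~ 0) l (quot_alg_pi I 'X_[m]).
Proof.
move=> mI ol /foldl_adjoinP[c].
pose h := \sum_(0 <= j < size l) l`_j * quot_alg_repr (c j).
have -> : \sum_(0 <= j < size l) l`_j *: c j = quot_alg_pi I h.
  rewrite quot_alg_pi_sum; apply: eq_bigr => j _.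
  by rewrite -quot_alg_piZ quot_alg_reprK.
rewrite -quot_alg_piB quot_alg_pi_eq0 => /mI; rewrite mcoeffB mcoeffX eqxx.
suff -> : h@_m = 0 by rewrite subr0 => /eqP; rewrite oner_eq0.
rewrite raddf_sum big_nat big1 // => j /= ltj.
apply: memN_msupp_eq0; apply/negP => /(_ : order_ge ((mdeg m).+1 + 0) _) hm.
suff /hm : order_ge ((mdeg m).+1 + 0) (l`_j * quot_alg_repr (c j)) by rewrite addn0 ltnn.
by apply: order_geM => //; apply/ol/mem_nth.
Qed.

Lemma depth_le (I : ringIdeal S) V m0 r :
  (forall i, i \in V -> 'X_i * 'X_[m0] \in I) -> (forall g, g \in I -> g@_m0 = 0) ->
  regular_seq_length (quot_alg I) (irrelevant_ideal k n) r -> (r <= #|~: V|)%N.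
Proof.
move=> m0V m0I [s [<- sX /regular_seqP[regs _]]]; rewrite leqNgt; apply/negP => ltVs.
have Nsub := @trivial_submod _ (quot_alg I).
(* The exponent [mdeg m0] + 1 pushes the order of every element above the degree of [m0], as
   [foldl_adjoin_order] requires. *)
have := wreg_exp (mdeg m0) Nsub regs; set l := map _ _ => regl.
have [|t ut tV] := @lex_unitary_in_vars k n V l; first by rewrite size_map.
have tz : t *: quot_alg_pi I 'X_[m0] = 0.
  rewrite quot_alg_piZ quot_alg_pi_eq0.
  apply: (@vars_ideal_sub (fun g => g * 'X_[m0] \in I)) tV => // [|g h|g h].
  - by rewrite mul0r rpred0.
  - by rewrite mulrDl => ? ?; apply: rpredD.
  - by rewrite -mulrA => ?; apply: ringIdealMr.
apply: (foldl_adjoin_order m0I) (wreg_lex_unitary Nsub regl ut tz) => _ /mapP[g gs ->].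
have /irrelevant_order_ge o1 : g \in irrelevant_ideal k n by apply: sX.
elim: (mdeg m0 : nat) => [|a IHa]; first by rewrite expr1.
by rewrite exprS -add1n; apply: order_geM.
Qed.

End PolynomialQuotients.

(** * Monomial ideals and regular sequences on their quotients *)

Section MonomialIdeals.
Variables (k : fieldType) (n : nat).
Local Notation S := {mpoly k[n]}.
Implicit Types (f g : S) (m w : 'X_{1..n}) (D : 'X_{1..n} -> Prop).

Definition mono_ideal D f : Prop := forall m, m \in msupp f -> D m.

Definition multiple_of (L : pred 'X_{1..n}) m : Prop := exists2 w, L w & (w <= m)%MM.

Lemma multiple_ofD L m m' : multiple_of L m -> multiple_of L (m + m')%MM.
Proof. by case=> w Lw wm; exists w => //; apply: lepm_trans wm (lem_addr _ _). Qed.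

Lemma lexsegment_idealP d u v f :
  f \in lexsegment_ideal k d u v <-> mono_ideal (multiple_of (lexsegment d u v)) f.
Proof.
split=> [/asboolP[s sX ->]|].
  elim: s sX => [|p s IH] sX m; first by rewrite big_nil msupp0.
  rewrite big_cons => /msuppD_le; rewrite mem_cat => /orP[|]; last first.
    by apply: IH => q qs; apply: sX; rewrite inE qs orbT.
  have [w Lw ->] := sX p (mem_head _ _).
  rewrite (perm_mem (msuppMX _ _)) => /mapP[m' _ ->].
  by exists w => //; apply: lem_addr.
move=> fD; apply: (@mpoly_closed_ind _ _ (fun f => f \in lexsegment_ideal k d u v)).
- exact: rpred0.
- by move=> g h; apply: rpredD.
move=> m /fD[w Lw wm]; rewrite -(submK wm) mpolyXD scalerAl.
apply: ringIdealMr; apply/asboolP; exists [:: (1, 'X_[w])].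
  by move=> p; rewrite inE => /eqP->; exists w.
by rewrite big_seq1 mul1r.
Qed.

Section RegularSeq.
Variable I : ringIdeal S.
Local Notation pi := (@quot_alg_pi S I).
Local Notation M := (quot_alg I).

Lemma adjoin_var (N : M -> Prop) D i : (forall f, N (pi f) <-> mono_ideal D f) ->
  forall f, adjoin N ('X_i : S) (pi f) <-> mono_ideal (fun m => D m \/ (0 < m i)%N) f.
Proof.
move=> ND f; have E g : N (pi f - ('X_i : S) *: pi g) <-> mono_ideal D (f - 'X_i * g).
  by rewrite quot_alg_piZ -quot_alg_piB.
split=> [[z]|].
  rewrite -[z]quot_alg_reprK E; set g := quot_alg_repr z => Dg m mf.
  have : m \in msupp ((f - 'X_i * g) + g * 'X_i) by rewrite [g * _]mulrC subrK.
  move/msuppD_le; rewrite mem_cat => /orP[/Dg|]; first by left.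
  rewrite (perm_mem (msuppMX _ _)) => /mapP[m' _ ->]; right.
  by rewrite mnmDE mnm1E eqxx.
pose Q f := exists g, mono_ideal D (f - 'X_i * g).
move=> fD; suff [g Dg] : Q f by exists (pi g); rewrite E.
apply: (@mpoly_closed_ind _ _ Q).
- by exists 0 => m; rewrite mulr0 subr0 msupp0.
- move=> g h [g' Dg] [h' Dh]; exists (g' + h') => m.
  by rewrite mulrDr opprD addrACA => /msuppD_le; rewrite mem_cat => /orP[/Dg|/Dh].
move=> m mf; have [Dm|mi] := fD m mf.
  exists 0 => m'; rewrite mulr0 subr0 => /msuppZ_le.
  by rewrite msuppX inE => /eqP->.
exists (f@_m *: 'X_[m - U_(i)]) => m'.
rewrite -scalerAr -mpolyXD addmC submK ?subrr ?msupp0 //.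
by apply/mnm_lepP => j; rewrite mnm1E; case: eqP => [<-|].
Qed.

Lemma foldl_adjoin_vars (N : M -> Prop) D (s : seq 'I_n) :
  (forall f, N (pi f) <-> mono_ideal D f) ->
  forall f, foldl (@adjoin S M) N [seq 'X_i | i <- s] (pi f) <->
            mono_ideal (fun m => D m \/ exists2 i, i \in s & (0 < m i)%N) f.
Proof.
elim: s N D => [|i s IH] N D ND f /=.
  rewrite ND; split=> Df m /Df; first by left.
  by case=> // -[].
rewrite (IH _ _ (adjoin_var i ND)); split=> Df m /Df.
- case=> [[|mi]|[j js mj]]; [by left|right..]; first by exists i; rewrite ?mem_head.
  by exists j; rewrite // inE js orbT.
- case=> [|[j]]; first by left; left.
  rewrite inE => /predU1P[->|js] mj; first by left; right.
  by right; exists j.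
Qed.

(** A variable that cancels from monomials of [D] still cancels after other variables are adjoined,
    because these are distinct from it. *)
Lemma wreg_vars (N : M -> Prop) D (s : seq 'I_n) :
  (forall f, N (pi f) <-> mono_ideal D f) -> uniq s ->
  (forall i m, i \in s -> D (m + U_(i))%MM -> D m) ->
  wreg N [seq ('X_i : S) | i <- s].
Proof.
elim: s N D => //= i s IH N D ND /andP[nis us] Ds; split.
  move=> z; rewrite -[z]quot_alg_reprK quot_alg_piZ !ND => Dz m mz.
  apply: (Ds i); rewrite ?mem_head // addmC; apply: Dz.
  by rewrite mulrC (perm_mem (msuppMX _ _)) map_f.
apply: IH (adjoin_var i ND) us _ => j m js [Dm|].
  by left; apply: Ds Dm; rewrite inE js orbT.
rewrite mnmDE mnm1E; case: eqP => [ji|_]; first by rewrite -ji js in nis.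
by rewrite addn0; right.
Qed.

(* Among the monomials of [f] outside the ideal, one of maximal degree in [x_a]
   meets no cancellation in [(x_a + x_b) f]. *)
Lemma mono_ideal_sum_regular D (a b : 'I_n) f : a != b ->
  (forall m, D m -> D (m + U_(b))%MM) ->
  (forall m, D (m + U_(a) + U_(a))%MM -> D (m + U_(a))%MM) ->
  (forall m, D (m + U_(a))%MM -> D (m + U_(b))%MM -> D m) ->
  mono_ideal D (('X_a + 'X_b) * f) -> mono_ideal D f.
Proof.
move=> neab Db Daa Dab Df m0 m0f; apply: contrapT => nDm0.
have coef i m : ('X_i * f)@_(m + U_(i)) = f@_m by rewrite mulrC addmC mcoeffMX.
(* If x_a m is outside [D], its coefficient in the product must cancel, and only a term x_b m' with
   m' in the support can do that. *)
have upa m : m \in msupp f -> ~ D (m + U_(a))%MM ->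
    exists m', [/\ m' \in msupp f, (m' + U_(b) = m + U_(a))%MM & ~ D m'].
  move=> mf nD; have [mb|mb] := boolP ((m + U_(a))%MM \in msupp ('X_b * f)).
    move: (mb); rewrite mulrC (perm_mem (msuppMX _ _)) => /mapP[m' m'f E].
    exists m'; split=> //; first by rewrite E addmC.
    by move=> Dm'; apply: nD; rewrite E addmC; apply: Db.
  case: nD; apply: Df; rewrite mcoeff_msupp mulrDl mcoeffD coef.
  by rewrite (memN_msupp_eq0 mb) addr0 -mcoeff_msupp.
pose B := (\max_(m <- msupp f) m a)%N.
(* If x_a divides m, [Daa] keeps x_a m outside [D], and [upa] gives an m' outside [D] with
   x_a-exponent one higher. Induction on the distance to the maximum [B] would make that exponent
   0. *)
have a0 c m : (B - m a < c)%N -> m \in msupp f -> ~ D m -> m a = 0%N.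
  elim: c m => // c IH m ltc mf nD; apply/eqP; rewrite -leqn0 leqNgt; apply/negP => ma.
  have mE : (m = m - U_(a) + U_(a))%MM.
    by rewrite submK //; apply/mnm_lepP => j; rewrite mnm1E; case: eqP => [<-|].
  have [|m' [m'f E nD']] := upa m mf; first by rewrite mE => /Daa; rewrite -mE.
  have := congr1 (fun x : 'X_{1..n} => x a) E.
  rewrite !mnmDE !mnm1E eqxx eq_sym (negPf neab) addn0 addn1 => ma'.
  have leB : (m' a <= B)%N by rewrite /B (big_rem m') //= leq_maxl.
  by have := IH m' _ m'f nD'; rewrite ma'; lia.
have m0a := a0 _ m0 (ltnSn _) m0f nDm0.
(* Since m0 lacks x_a, the term x_b m0 meets nothing from x_a f, hence lies in [D]. If x_a m0 were
   outside [D], [upa] would give an m' with x_a-exponent 1, against [a0]. *)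
apply: (nDm0); apply: Dab; last first.
  apply: Df; rewrite mcoeff_msupp mulrDl mcoeffD coef.
  rewrite (memN_msupp_eq0 (_ : _ \notin msupp ('X_a * f))) ?add0r -?mcoeff_msupp //.
  rewrite mulrC (perm_mem (msuppMX _ _)); apply/mapP.
  move=> -[m' _ /(congr1 (fun x : 'X_{1..n} => x a))].
  by rewrite !mnmDE !mnm1E eqxx [b == a]eq_sym (negPf neab) m0a.
apply: contrapT => /(upa _ m0f)[m' [m'f E nD']].
have := congr1 (fun x : 'X_{1..n} => x a) E.
by rewrite !mnmDE !mnm1E eqxx [b == a]eq_sym (negPf neab) m0a (a0 _ m' (ltnSn _)).
Qed.

(** The quotient by the variables of [s] is again described by monomials, so
    [mono_ideal_sum_regular] applies with [D] enlarged by their multiples; the last condition is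
    then left only for m free of these variables. *)
Lemma regular_seq_vars_sum D (s : seq 'I_n) (a b : 'I_n) :
  (forall f, f \in I <-> mono_ideal D f) -> ~ D 0%MM -> uniq s -> a != b ->
  (forall m i, D m -> D (m + U_(i))%MM) ->
  (forall i m, i \in s -> D (m + U_(i))%MM -> D m) ->
  a \notin s -> b \notin s ->
  (forall m, D (m + U_(a) + U_(a))%MM -> D (m + U_(a))%MM) ->
  (forall m, {in s, forall i, m i = 0%N} ->
     D (m + U_(a))%MM -> D (m + U_(b))%MM -> D m) ->
  regular_seq_length M (irrelevant_ideal k n) (size s).+1.
Proof.
move=> ID nD0 us neab Dup Ds nas nbs Daa Dab.
have N0D f : pi f = 0 <-> mono_ideal D f by rewrite quot_alg_pi_eq0.
pose l := rcons [seq ('X_i : S) | i <- s] ('X_a + 'X_b).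
have XI i : 'X_i \in irrelevant_ideal k n.
  apply/asboolP; exists [:: (1, 'X_i)]; last by rewrite big_seq1 mul1r.
  by move=> p; rewrite inE => /eqP->; exists i.
have lI : {subset l <= irrelevant_ideal k n}.
  move=> g; rewrite mem_rcons inE => /predU1P[->|/mapP[i _ ->] //].
  exact: rpredD.
exists l; split=> //; first by rewrite size_rcons size_map.
apply/regular_seqP; split; last first.
  exists (pi 'X_[0]); apply: foldl_adjoin_order => [g /ID Dg|g gl].
    by apply: memN_msupp_eq0; apply/negP => /Dg.
  by rewrite mdeg0; apply/irrelevant_order_ge/lI.
rewrite /l -cats1 wreg_cat; split; first exact: (wreg_vars N0D us Ds).
split=> // z; rewrite -[z]quot_alg_reprK quot_alg_piZ !(foldl_adjoin_vars _ N0D).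
have in_sU c i m : c \notin s -> i \in s -> (m + U_(c))%MM i = m i.
  move=> nc si; rewrite mnmDE mnm1E; case: eqP => [E|]; last by rewrite addn0.
  by rewrite E si in nc.
apply: mono_ideal_sum_regular neab _ _ _ => m.
- case=> [Dm|[i si mi]]; [by left; apply: Dup|right].
  by exists i; rewrite // in_sU.
- case=> [Dm|[i si mi]]; [by left; apply: Daa|right].
  by exists i; rewrite // -(in_sU a).
- case=> [Dma|[i si mi]]; last by move=> _; right; exists i; rewrite // -(in_sU a).
  case=> [Dmb|[i si mi]]; last by right; exists i; rewrite // -(in_sU b).
  have [[i si mi]|no] := pselect (exists2 i, i \in s & (0 < m i)%N).
    by right; exists i.
  left; apply: Dab => // i si; apply/eqP; rewrite -leqn0 leqNgt.
  by apply/negP => mi; apply: no; exists i.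
Qed.

End RegularSeq.
End MonomialIdeals.

(** * The pure lexicographic order on exponent vectors *)

Section LexOrder.
Variable n : nat.
Implicit Types (a b c m w : 'X_{1..n}) (i j : 'I_n).

Lemma lex_ltP a b :
  reflect (exists j, (forall i, (i < j)%N -> a i = b i) /\ (a j < b j)%N) (lex_lt a b).
Proof.
apply: (iffP (@Order.TupleLexiOrder.ltxi_tuplePlt _ _ n _ a b)) => [[j eqj ltj]|[j [eqj ltj]]];
  exists j => //.
Qed.

Lemma lex_leNgt a b : lex_le a b = ~~ lex_lt b a.
Proof. exact: leNgt. Qed.

Lemma lex_le_anti a b : lex_le a b -> lex_le b a -> a = b.
Proof.
move=> ab ba; apply: val_inj.
by apply: (@le_anti _ (n.-tuplelexi nat)); apply/andP; split.
Qed.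

Lemma lex_le_trans b a c : lex_le a b -> lex_le b c -> lex_le a c.
Proof. exact: le_trans. Qed.

Lemma lex_lt_le_trans b a c : lex_lt a b -> lex_le b c -> lex_lt a c.
Proof. exact: lt_le_trans. Qed.

Lemma lex_le_lt_trans b a c : lex_le a b -> lex_lt b c -> lex_lt a c.
Proof. exact: le_lt_trans. Qed.

Lemma lex_le_add2r c a b : lex_le (a + c)%MM (b + c)%MM = lex_le a b.
Proof.
rewrite !lex_leNgt; congr (~~ _); apply/lex_ltP/lex_ltP => -[j [eqj ltj]]; exists j.
  split=> [i /eqj|]; last by move: ltj; rewrite !mnmDE ltn_add2r.
  by rewrite !mnmDE => /addIn.
by split=> [i /eqj|]; rewrite !mnmDE ?ltn_add2r // => ->.
Qed.

Lemma lex_le_addU m i j : (i <= j)%N -> lex_le (m + U_(j))%MM (m + U_(i))%MM.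
Proof.
move=> leij; rewrite ![(m + _)%MM]addmC lex_le_add2r lex_leNgt.
apply/negP => /lex_ltP[l [eql]]; rewrite !mnm1E.
have [<-|neil] := eqVneq i l; first by case: eqP.
have [jl _|//] := eqVneq j l; have := eql i; rewrite !mnm1E eqxx jl eq_sym (negPf neil).
by rewrite -jl ltn_neqAle leij val_eqE jl neil => /(_ isT).
Qed.

Lemma lepm_mdeg_eq a b : (a <= b)%MM -> mdeg a = mdeg b -> a = b.
Proof.
move=> leab; rewrite -(submK leab) mdegD -[LHS]add0n => /addIn/esym/eqP.
by rewrite mdeg_eq0 => /eqP->; rewrite add0m.
Qed.

Lemma mnm_eq_except i a b :
  mdeg a = mdeg b -> (forall j, j != i -> a j = b j) -> a = b.
Proof.
move=> degab eqab; apply/mnmP => j; have [->|/eqab //] := eqVneq j i.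
move: degab; rewrite !mdegE (bigD1 i) //= [in RHS](bigD1 i) //=.
by rewrite (eq_bigr _ (fun j => @eqab j)) => /addIn.
Qed.

Lemma mon_varE i : mon_var n i.+1 = U_(i)%MM.
Proof. by apply/mnmP => j; rewrite mnmE mnm1E eqSS val_eqE eq_sym. Qed.

Lemma mon_expE m i : mon_exp m i.+1 = m i.
Proof. by rewrite /mon_exp /= (mnm_nth 0). Qed.

Lemma lexsegment_mdeg d u v w : lexsegment d u v w -> mdeg w = d.
Proof. by case/and3P=> /eqP. Qed.

End LexOrder.

Section LexLast.
Variable n : nat.
Implicit Types (a b m w : 'X_{1..n.+1}).

(** In equal degree the last exponent is determined by the others, so a first difference occurs
    before it. *)
Lemma lex_le_except_last a b :
  mdeg a = mdeg b -> (forall j, j != ord_max -> (a j <= b j)%N) -> lex_le a b.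
Proof.
move=> degab leab; rewrite lex_leNgt; apply/negP => /lex_ltP[j [eqj ltj]].
have [jmax|/leab] := eqVneq j ord_max; last by rewrite leqNgt ltj.
suff E : a = b by rewrite E ltnn in ltj.
apply: (@mnm_eq_except _ ord_max) => // i neqi; rewrite eqj // jmax.
by rewrite ltn_neqAle neqi leq_ord.
Qed.

End LexLast.

(** * Depth bounds and prime chains for lexsegment ideals *)

Section LexsegmentIdeals.
Variables (k : fieldType) (n d : nat) (u v : 'X_{1..n}).
Local Notation L := (lexsegment d u v).
Local Notation I := (lexsegment_ideal k d u v).
Implicit Types (m w : 'X_{1..n}) (V : {set 'I_n}).

Lemma lexsegment_multiple m w : L w -> (w <= m)%MM -> multiple_of L m.
Proof. by exists w. Qed.

Lemma not_multiple_mdeg m : (mdeg m < d)%N -> ~ multiple_of L m.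
Proof.
move=> ltmd [w /lexsegment_mdeg wd wm].
by move: ltmd; rewrite -wd -(submK wm) mdegD ltnNge leq_addl.
Qed.

Lemma lexsegment_depth_le V m r :
  (forall i, i \in V -> multiple_of L (m + U_(i))%MM) -> ~ multiple_of L m ->
  regular_seq_length (quot_alg I) (irrelevant_ideal k n) r -> (r <= #|~: V|)%N.
Proof.
move=> mV nm; apply: (@depth_le _ _ _ _ m) => [i /mV Lm|g /lexsegment_idealP gL].
  apply/lexsegment_idealP => w; rewrite -mpolyXD msuppX inE => /eqP->.
  by rewrite addmC.
by apply: memN_msupp_eq0; apply/negP => /gL.
Qed.

(** The chain starts at (x_1, ..., x_q), which contains the ideal because each generator involves
    one of these variables. *)
Lemma lexsegment_prime_chain q : (q <= n)%N ->
  (forall w, L w -> exists2 i : 'I_n, (i < q)%N & (0 < w i)%N) ->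
  prime_chain (quot_alg I) (n - q).
Proof.
move=> leqn Lq; apply: prime_chain_vars => // f /lexsegment_idealP fL.
apply: (@mpoly_closed_ind _ _ (fun f => kill_vars q f = 0)).
- exact: kill_vars0.
- by move=> g h; rewrite kill_varsD => -> ->; rewrite addr0.
move=> m /fL[w /Lq[i ltiq wi] /mnm_lepP/(_ i) wm].
rewrite kill_varsZ kill_varsX (bigD1 i) //= ltiq.
by rewrite expr0n eqn0Ngt (leq_trans wi wm) mul0r scaler0.
Qed.

Lemma lexsegment_mpolyX w : L w -> 'X_[w] \in I.
Proof.
move=> Lw; apply/lexsegment_idealP => m; rewrite msuppX inE => /eqP->.
by exists w => //; apply: lepm_refl.
Qed.

Lemma lexsegment_prime_var P i e : prime_ideal P -> L (U_(i) *+ e)%MM ->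
  P (quot_alg_pi I 'X_i).
Proof.
move=> primeP /lexsegment_mpolyX /quot_alg_pi_eq0 L0.
by apply: (prime_ideal_varXn (e := e)) => //; rewrite L0; case: primeP.
Qed.

End LexsegmentIdeals.

(** * Depth bounds in n = N + 3 variables, with positions counted from 0 and [xp] for x_(n-1) *)

Section Combinatorics.
Variables (k : fieldType) (N d : nat) (u v : 'X_{1..N.+3}).
Hypotheses (hu : mdeg u = d) (hv : mdeg v = d).
Local Notation x1 := (@ord0 N.+2).
Local Notation x2 := (@Ordinal N.+3 1 isT).
Local Notation xp := (@Ordinal N.+3 N.+1 (leqnSn N.+2)).
Local Notation xn := (@ord_max N.+2).
Hypothesis huv : (v x1 < u x1)%N.
Local Notation L := (lexsegment d u v).
Local Notation I := (lexsegment_ideal k d u v).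
Local Notation rsl := (regular_seq_length (quot_alg I) (irrelevant_ideal k N.+3)).
Local Notation b := (v x1).
Local Notation e := (d - b).-1.
Implicit Types (w m : 'X_{1..N.+3}) (i j : 'I_N.+3).

Lemma lex_lt_first m w : (m x1 < w x1)%N -> lex_lt m w.
Proof. by move=> lt1; apply/lex_ltP; exists x1; split=> // i; rewrite ltn0. Qed.

Lemma lex_le_first m w : lex_le m w -> (m x1 <= w x1)%N.
Proof. by rewrite lex_leNgt leqNgt; apply/contra/lex_lt_first. Qed.

Lemma lexsegmentI w : mdeg w = d -> lex_le w u -> lex_le v w -> L w.
Proof. by move=> wd wu vw; rewrite /lexsegment wd eqxx wu. Qed.

Lemma lex_ltW m w : lex_lt m w -> lex_le m w.
Proof. exact: ltW. Qed.

(** As b < a_1 <= d, the truncated differences in [e] are exact. *)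
Lemma deg_split : d = (b + e.+1)%N.
Proof.
have : (u x1 <= d)%N by rewrite -hu mdegE (bigD1 x1) //= leq_addr.
by lia.
Qed.

Lemma subm_x1K : (u - U_(x1) + U_(x1) = u)%MM.
Proof.
by apply/submK/mnm_lepP => i; rewrite mnm1E; case: eqP => // <-; apply: leq_ltn_trans huv.
Qed.

(** Every x_i u / x_1 lies between x_n u / x_1 and u, so all variables kill the class of u / x_1. *)
Lemma depth_le_socle r : lex_le v (u - U_(x1) + U_(xn))%MM -> rsl r -> (r <= 0)%N.
Proof.
move=> lev /(lexsegment_depth_le (V := setT) (m := (u - U_(x1))%MM)).
have degu : (mdeg (u - U_(x1))%MM).+1 = d by rewrite -hu -[in RHS]subm_x1K mdegD mdeg1 addn1.
rewrite setCT cards0; apply=> [i _|]; last by apply: not_multiple_mdeg; rewrite -degu.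
apply: lexsegment_multiple (lepm_refl _); apply: lexsegmentI.
- by rewrite mdegD mdeg1 addn1.
- by rewrite -[X in lex_le _ X]subm_x1K; apply: lex_le_addU.
- by apply: lex_le_trans lev _; apply: lex_le_addU; apply: leq_ord.
Qed.

Lemma u_x1 : lex_lt (u - U_(x1) + U_(xn))%MM v -> u x1 = b.+1.
Proof.
move/lex_ltW/lex_le_first; rewrite mnmDE mnmBE !mnm1E -?val_eqE /=; lia.
Qed.

Let p i : 'X_{1..N.+3} := (U_(x1) *+ b + U_(x2) *+ e + U_(i))%MM.

Lemma mdeg_p i : mdeg (p i) = d.
Proof. by rewrite /p !mdegD !mdegMn !mdeg1 [in RHS]deg_split; lia. Qed.

(** For i > 1, x_i x_1^b x_2^e is below [u] by its x_1-exponent and at least [p xn], so only x_1 may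
    fail to kill x_1^b x_2^e. *)
Lemma depth_le_one r : lex_le v (p xn) -> rsl r -> (r <= 1)%N.
Proof.
move=> lev /(lexsegment_depth_le (V := [set~ x1]) (m := (U_(x1) *+ b + U_(x2) *+ e)%MM)).
rewrite setCK cards1; apply=> [i|].
  rewrite !inE => i1; apply: lexsegment_multiple (lepm_refl _); apply: lexsegmentI.
  - exact: mdeg_p.
  - apply/lex_ltW/lex_lt_first; move: i1.
    by rewrite !(mnmDE, mulmnE, mnm1E) -!val_eqE /= => /negPf->; lia.
  - by apply: lex_le_trans lev _; apply: lex_le_addU; apply: leq_ord.
apply: not_multiple_mdeg; rewrite -[X in (_ < X)%N](mdeg_p x1).
by rewrite /p [in X in (_ < X)%N]mdegD mdeg1 addn1.
Qed.

(** At the first difference [j] the exponent of [v] is larger than that of [p xn], so [p j] divides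
    [v], and the degrees agree. *)
Lemma v_eq_p : lex_lt (p xn) v -> exists j, [/\ (0 < j)%N, (j < N.+2)%N & v = p j].
Proof.
case/lex_ltP=> j [eqj ltj].
have j0 : (0 < j)%N.
  rewrite lt0n; apply: contraTneq ltj => j0; have -> : j = x1 by apply: val_inj.
  by rewrite !(mnmDE, mulmnE, mnm1E) -!val_eqE /=; lia.
have jn : (j < N.+2)%N.
  rewrite ltnNge; apply: contraTN ltj => lej.
  have jn : j = xn by apply/val_inj/eqP; rewrite /= eqn_leq lej leq_ord.
  suff -> : v = p xn by rewrite ltnn.
  apply: (@mnm_eq_except _ xn) => [|i ni]; first by rewrite mdeg_p.
  by rewrite -eqj // jn ltn_neqAle leq_ord andbT; apply: contra ni.
exists j; split=> //; apply/esym/lepm_mdeg_eq; last by rewrite mdeg_p.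
apply/mnm_lepP => i; have := eqj i; have := eqj x2; move: ltj; have [->|nij] := eqVneq i j.
  move=> + E2 _; move: E2; rewrite !(mnmDE, mulmnE, mnm1E) -!val_eqE /=.
  have [j1|nj1] := eqVneq j x2; first by rewrite j1 /=; lia.
  move: nj1; rewrite -val_eqE /=; lia.
move=> _ + E; have [ltij|ltji|] := ltngtP i j; last by move/val_inj=> ij; rewrite ij eqxx in nij.
- move=> _; rewrite -E //.
  by rewrite !(mnmDE, mulmnE, mnm1E) -!val_eqE /=; lia.
- move=> _; rewrite !(mnmDE, mulmnE, mnm1E) -!val_eqE /=; lia.
Qed.

Lemma card_initial j : #|~: [set i : 'I_N.+3 | (i <= j)%N]| = (N.+2 - j)%N.
Proof.
have := cardsC [set i : 'I_N.+3 | (i <= j)%N]; rewrite card_ord.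
suff -> : #|[set i : 'I_N.+3 | (i <= j)%N]| = j.+1 by have := ltn_ord j; lia.
rewrite cardsE -sum1_card (eq_bigl (fun i : 'I_N.+3 => (i < j.+1)%N)) //.
by rewrite -(big_ord_widen _ (fun=> 1%N)) // sum_nat_const card_ord muln1.
Qed.

(** On the class of x_1^b x_2^e x_n^e, x_1 acts through x_1^(b+1) x_n^e, the least monomial with its
    x_1-exponent, and the other variables up to [j] through [p i] >= [p j]. *)
Lemma depth_le_initial j r : u x1 = b.+1 -> (0 < j)%N -> (j < N.+2)%N -> v = p j ->
  rsl r -> (r <= N.+2 - j)%N.
Proof.
move=> hu1 j0 jn hvj.
move/(lexsegment_depth_le (V := [set i : 'I_N.+3 | (i <= j)%N])
  (m := (U_(x1) *+ b + U_(x2) *+ e + U_(xn) *+ e)%MM)).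
rewrite card_initial; apply=> [i|].
  rewrite inE => lei; have [->|ni1] := eqVneq i x1.
    apply: (@lexsegment_multiple _ _ _ _ _ (U_(x1) *+ b.+1 + U_(xn) *+ e)%MM).
      apply: lexsegmentI.
      - by rewrite mdegD !mdegMn !mdeg1 [in RHS]deg_split; lia.
      - apply: lex_le_except_last => [|i' ni].
          by rewrite hu mdegD !mdegMn !mdeg1 [in RHS]deg_split; lia.
        rewrite !(mnmDE, mulmnE, mnm1E) [xn == i']eq_sym (negPf ni).
        by case: eqP => [<-|]; rewrite ?hu1; lia.
      - by apply/lex_ltW/lex_lt_first; rewrite !(mnmDE, mulmnE, mnm1E) -!val_eqE /=; lia.
    by apply/mnm_lepP => i'; rewrite !(mnmDE, mulmnE, mnm1E); lia.
  apply: (@lexsegment_multiple _ _ _ _ _ (p i)).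
    apply: lexsegmentI; first exact: mdeg_p.
      apply/lex_ltW/lex_lt_first; rewrite hu1 !(mnmDE, mulmnE, mnm1E) (negPf ni1) -!val_eqE /=; lia.
    by rewrite {1}hvj; apply: lex_le_addU.
  by apply/mnm_lepP => i'; rewrite !(mnmDE, mulmnE, mnm1E); lia.
(* Outside x_n the exponents of a divisor w are at most those of [p xn], so w <= [p xn] < v. *)
case=> w /and3P[/eqP wd _ vw] /mnm_lepP wm.
have : lex_le v (p xn).
  apply: lex_le_trans vw _; apply: lex_le_except_last => [|i ni]; first by rewrite mdeg_p.
  apply: leq_trans (wm i) _; rewrite !(mnmDE, mulmnE, mnm1E) [xn == i]eq_sym (negPf ni); lia.
rewrite {1}hvj lex_leNgt => /negP; apply; apply/lex_ltP; exists j.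
split=> [i ltij|]; rewrite !(mnmDE, mulmnE, mnm1E) -!val_eqE /=; last by rewrite eqxx; lia.
by lia.
Qed.

Hypothesis hd : (2 <= d)%N.

Let q i : 'X_{1..N.+3} := (U_(x1) + U_(i) + U_(xn) *+ (d - 2))%MM.

Lemma mdeg_q i : mdeg (q i) = d.
Proof. by rewrite /q !mdegD mdegMn !mdeg1; lia. Qed.

(** x_1 x_n^(d-1) is the least monomial of degree d divisible by x_1, hence lies in the
    lexsegment. *)
Lemma x1xn_in m : v x1 = 0%N -> (0 < m x1)%N -> (d.-1 <= m xn)%N -> multiple_of L m.
Proof.
move=> hv1 m1 mn; apply: (@lexsegment_multiple _ _ _ _ _ (U_(x1) + U_(xn) *+ d.-1)%MM).
  apply: lexsegmentI; first by rewrite mdegD mdegMn !mdeg1; lia.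
    apply: lex_le_except_last => [|i ni]; first by rewrite hu mdegD mdegMn !mdeg1; lia.
    rewrite !(mnmDE, mulmnE, mnm1E) [xn == i]eq_sym (negPf ni).
    case: eqP => [<-|]; last by lia.
    by move: huv; lia.
  by apply/lex_ltW/lex_lt_first; rewrite hv1 !(mnmDE, mulmnE, mnm1E).
apply/mnm_lepP => i; rewrite !(mnmDE, mulmnE, mnm1E).
have [<-|n1] := eqVneq x1 i; first by rewrite -val_eqE /=; lia.
by have [<-|] := eqVneq xn i; lia.
Qed.

(** The variables x_2, x_(n-1), x_n, distinct as n >= 4, kill a nonzero class whose choice depends
    on whether x_1 x_2 x_n^(d-2) <= u. *)
Lemma depth_le_codim3 r : (0 < N)%N -> u x1 = 1%N -> v = (U_(x2) *+ d)%MM ->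
  u <> (U_(x1) + U_(xn) *+ d.-1)%MM -> rsl r -> (r <= N)%N.
Proof.
move=> N0 hu1 hv2 neu.
have hv1 : v x1 = 0%N by rewrite hv2 mulmnE mnm1E.
have cardV : #|~: [set x2; xp; xn]| = N.
  have := cardsC [set x2; xp; xn]; rewrite card_ord.
  by rewrite -setUA cardsU1 cards2 !inE -!val_eqE /= !eqSS; lia.
have lt_v_q i : lex_le v (q i).
  by apply/lex_ltW/lex_lt_first; rewrite hv1 !(mnmDE, mulmnE, mnm1E) eqxx.
(* Among monomials of degree d divisible by x_1, only x_1 x_n^(d-1) is below x_1 x_(n-1) x_n^(d-2),
   and [neu] excludes it. *)
have qp_u : lex_le (q xp) u.
  rewrite lex_leNgt; apply/negP => /lex_ltP[j [eqj ltj]].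
  have eqi i : (0 < i)%N -> (i < N.+1)%N -> (i < j)%N -> u i = 0%N.
    by move=> i0 iN /eqj->; rewrite !(mnmDE, mulmnE, mnm1E) -!val_eqE /=; lia.
  have jp : (N.+1 <= j)%N.
    rewrite leqNgt; apply/negP => ltjp; move: ltj.
    have [j1|j0] := posnP j; last by rewrite !(mnmDE, mulmnE, mnm1E) -!val_eqE /=; lia.
    have -> : j = x1 by apply: val_inj.
    by rewrite hu1 !(mnmDE, mulmnE, mnm1E) -!val_eqE /=; lia.
  apply: neu; apply: (@mnm_eq_except _ xn) => [|i].
    by rewrite mdegD mdegMn !mdeg1; lia.
  rewrite -val_eqE /= => ni; have := ltn_ord i => ltiN.
  have [i0|i0] := posnP i.
    have -> : i = x1 by apply: val_inj.
    by rewrite hu1 !(mnmDE, mulmnE, mnm1E) -!val_eqE /=; lia.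
  have [ltip|leip] := ltnP i N.+1.
    by rewrite eqi // ?(leq_trans ltip) // !(mnmDE, mulmnE, mnm1E) -!val_eqE /=; lia.
  have -> : i = xp by apply: val_inj; rewrite /=; lia.
  rewrite [RHS](_ : _ = 0%N); last by rewrite !(mnmDE, mulmnE, mnm1E) -!val_eqE /=; lia.
  move: jp; rewrite leq_eqVlt => /orP[/eqP jp|jn].
    have -> : xp = j by apply: val_inj.
    move: ltj; rewrite !(mnmDE, mulmnE, mnm1E) -!val_eqE /=; lia.
  have jE : j = xn by apply: val_inj => /=; have := ltn_ord j; lia.
  suff E : u = q xp by rewrite E ltnn in ltj.
  apply: (@mnm_eq_except _ xn) => [|i']; first by rewrite mdeg_q.
  by rewrite -val_eqE /= => ni'; apply: eqj; rewrite jE /= ltn_neqAle ni' -ltnS ltn_ord.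
have q_in i : lex_le (q i) u -> L (q i).
  by move=> qu; apply: lexsegmentI; rewrite ?mdeg_q.
have [q2u|uq2] := boolP (lex_le (q x2) u).
  move/(lexsegment_depth_le (V := [set x2; xp; xn]) (m := (U_(x1) + U_(xn) *+ (d - 2))%MM)).
  rewrite cardV; apply=> [i|]; last first.
    by apply: not_multiple_mdeg; rewrite mdegD mdegMn !mdeg1; lia.
  rewrite !inE -orbA => /or3P[] /eqP->.
  - apply: lexsegment_multiple (q_in _ q2u) _.
    by apply/mnm_lepP => j; rewrite !(mnmDE, mulmnE, mnm1E); lia.
  - apply: lexsegment_multiple (q_in _ qp_u) _.
    by apply/mnm_lepP => j; rewrite !(mnmDE, mulmnE, mnm1E); lia.
  - by apply: x1xn_in => //; rewrite !(mnmDE, mulmnE, mnm1E) -!val_eqE /=; lia.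
(* Now x_1 x_2 x_n^(d-2) exceeds u, so x_2 has to act through v = x_2^d; hence the factor
   x_2^(d-1). *)
rewrite lex_leNgt negbK in uq2.
move/(lexsegment_depth_le (V := [set x2; xp; xn])
  (m := (U_(x1) + U_(xn) *+ (d - 2) + U_(x2) *+ d.-1)%MM)).
rewrite cardV; apply=> [i|].
  rewrite !inE -orbA => /or3P[] /eqP->.
  - apply: (@lexsegment_multiple _ _ _ _ _ v).
      apply: lexsegmentI => //; last exact: lexx.
      exact/lex_ltW/lex_lt_first.
    by rewrite hv2; apply/mnm_lepP => i'; rewrite !(mnmDE, mulmnE, mnm1E); lia.
  - apply: lexsegment_multiple (q_in _ qp_u) _.
    by apply/mnm_lepP => i'; rewrite !(mnmDE, mulmnE, mnm1E); lia.
  - by apply: x1xn_in => //; rewrite !(mnmDE, mulmnE, mnm1E) -!val_eqE /=; lia.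
case=> w /and3P[/eqP wd wu vw] /mnm_lepP wm.
have w0 i : (1 < i)%N -> (i < N.+2)%N -> w i = 0%N.
  by move=> i1 iN; have := wm i; rewrite !(mnmDE, mulmnE, mnm1E) -!val_eqE /=; lia.
have := wm x1; rewrite !(mnmDE, mulmnE, mnm1E) -!val_eqE /= => w1.
have := wm x2; rewrite !(mnmDE, mulmnE, mnm1E) -!val_eqE /= => w2.
have := wm xn; rewrite !(mnmDE, mulmnE, mnm1E) -!val_eqE /= => wn.
have degw : mdeg w = (w x1 + w x2 + w xn)%N.
  rewrite mdegE (bigD1 x1) //= (bigD1 x2) //= (bigD1 xn) //= big1 ?addn0 ?addnA //.
  by move=> i; rewrite -!val_eqE /= => ?; apply: w0; have := ltn_ord i; lia.
(* Without x_1, w has x_2-exponent below d and falls below v. With x_1 it needs x_2, as its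
   x_n-exponent is at most d - 2, and then w >= x_1 x_2 x_n^(d-2) > u. *)
have [w10|w1p] := posnP (w x1).
  move: vw; rewrite lex_leNgt => /negP; apply; apply/lex_ltP; exists x2; split=> [i|].
    by rewrite ltnS leqn0 => /eqP i0; have -> : i = x1 by [apply: val_inj]; rewrite w10 hv1.
  by rewrite hv2 mulmnE mnm1E eqxx; lia.
suff : lex_le (q x2) u by rewrite lex_leNgt uq2.
apply: lex_le_trans wu; apply: lex_le_except_last; first by rewrite mdeg_q wd.
move=> i; rewrite !(mnmDE, mulmnE, mnm1E) -!val_eqE /= => ni.
have [i0|i0] := posnP i; first by have -> : i = x1 by [apply: val_inj]; rewrite /=; lia.
have [i1|i1] := eqVneq (i : nat) 1%N; last by lia.
by have -> : i = x2 by [apply: val_inj]; rewrite /=; lia.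
Qed.

(** Generators are at most [u], so none is divisible by x_1^2. *)
Lemma x1_square m : u x1 = 1%N ->
  multiple_of L (m + U_(x1) + U_(x1))%MM -> multiple_of L (m + U_(x1))%MM.
Proof.
move=> hu1 [w Lw wm]; apply: lexsegment_multiple (Lw) _.
have /and3P[_ /lex_le_first w1 _] := Lw; rewrite hu1 in w1.
apply/mnm_lepP => i; have /mnm_lepP/(_ i) := wm.
rewrite !(mnmDE, mulmnE, mnm1E); have [<-|] := eqVneq x1 i; lia.
Qed.

Lemma not_multiple0 : ~ multiple_of L 0%MM.
Proof. by apply: not_multiple_mdeg; rewrite mdeg0; lia. Qed.

Lemma regular_sum : v x1 = 0%N -> lex_lt (u - U_(x1) + U_(xn))%MM v -> rsl 1.
Proof.
move=> hv1 ltv; have hu1 : u x1 = 1%N by rewrite (u_x1 ltv) hv1.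
apply: (regular_seq_vars_sum (s := [::]) (a := x1) (b := xn) (@lexsegment_idealP k _ d u v)) => //.
- exact: not_multiple0.
- by move=> m i; apply: multiple_ofD.
- by move=> m; apply: x1_square.
move=> m _ [w Lw wm] [w' Lw' wm'].
have /and3P[/eqP wd wu vw] := Lw; have /and3P[/eqP wd' wu' vw'] := Lw'.
have [|nwm] := boolP (w <= m)%MM; first exact: lexsegment_multiple Lw.
have [|nwm'] := boolP (w' <= m)%MM; first exact: lexsegment_multiple Lw'.
have w1 := lex_le_first wu; rewrite hu1 in w1.
have exceed (z : 'X_{1..N.+3}) i : (z <= m + U_(i))%MM -> ~~ (z <= m)%MM -> z i = (m i).+1.
  move=> zm nzm; apply/eqP; rewrite eqn_leq; have /mnm_lepP zm' := zm.
  have := zm' i; rewrite mnmDE mnm1E eqxx addn1 => -> /=.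
  rewrite ltnNge; apply: contra nzm => zi; apply/mnm_lepP => j.
  by have := zm' j; rewrite mnmDE mnm1E; have [<-//|_] := eqVneq i j; rewrite addn0.
have m1 : m x1 = 0%N by move: w1; rewrite (exceed _ _ wm nwm) ltnS leqn0 => /eqP.
have w1' : w' x1 = 0%N.
  by have /mnm_lepP/(_ x1) := wm'; rewrite mnmDE mnm1E m1 leqn0 => /eqP.
have wn' := exceed _ _ wm' nwm'.
have Un' : (U_(xn) <= w')%MM by apply/mnm_lepP => i; rewrite mnm1E; case: eqP => // <-; rewrite wn'.
have wUm : (w' - U_(xn) <= m)%MM.
  by apply/mnm_lepP => i; have /mnm_lepP/(_ i) := wm'; rewrite mnmBE mnmDE leq_subLR addnC.
(* If w' = x_n m, then w = x_1 m by degree, and w <= u gives w' <= x_n u / x_1 < v. *)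
have [E|ne] := eqVneq (w' - U_(xn))%MM m.
  have E' : w' = (m + U_(xn))%MM by rewrite -E submK.
  have Ew : w = (m + U_(x1))%MM.
    by apply: lepm_mdeg_eq => //; rewrite wd mdegD mdeg1 -E -wd' -[in LHS](submK Un') mdegD mdeg1.
  have : lex_le w' (u - U_(x1) + U_(xn))%MM.
    by rewrite E' lex_le_add2r -(lex_le_add2r U_(x1)) subm_x1K -Ew.
  move/lex_le_lt_trans/(_ ltv)/lex_lt_le_trans/(_ vw').
  by rewrite /lex_lt ltxx.
(* Otherwise w' / x_n divides m properly. Replacing x_n in w' by a variable x_i of the cofactor
   gives a divisor of m that stays above v and, lacking x_1, below u. *)
have [i ltim] : exists i, ((w' - U_(xn))%MM i < m i)%N.
  apply: contrapT => no; case/eqP: ne; apply/mnmP => i; apply/eqP.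
  rewrite eqn_leq (mnm_lepP wUm) leqNgt; apply/negP => lti; apply: no.
  by exists i.
have i1 : i != x1 by apply: contraTneq ltim => ->; rewrite m1.
apply: (@lexsegment_multiple _ _ _ _ _ (w' - U_(xn) + U_(i))%MM); last first.
  apply/mnm_lepP => j; rewrite mnmDE mnm1E; have [<-|_] := eqVneq i j; first by rewrite addn1.
  by rewrite addn0 (mnm_lepP wUm).
apply: lexsegmentI.
- by rewrite mdegD mdeg1 -wd' -[in RHS](submK Un') mdegD mdeg1.
- by apply/lex_ltW/lex_lt_first; rewrite hu1 mnmDE mnmBE w1' !mnm1E (negPf i1).
- apply: lex_le_trans vw' _; rewrite -{1}(submK Un'); apply: lex_le_addU; exact: leq_ord.
Qed.

Lemma prime_x1_or_xn P : v x1 = 0%N -> prime_ideal P ->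
  P (quot_alg_pi I 'X_x1) \/ P (quot_alg_pi I 'X_xn).
Proof.
move=> hv1 primeP; have [P0 _ _ _ PM] := primeP.
have x1n : 'X_[U_(x1) + U_(xn) *+ d.-1] \in I.
  apply/lexsegment_idealP => m; rewrite msuppX inE => /eqP->.
  by apply: x1xn_in => //; rewrite !(mnmDE, mulmnE, mnm1E) -!val_eqE /=; lia.
have : P (quot_alg_pi I 'X_[U_(x1) + U_(xn) *+ d.-1]).
  by rewrite (quot_alg_pi_eq0 _ _).2.
rewrite mpolyXD quot_alg_piM => /PM[|Pn]; first by left.
by right; apply: prime_ideal_varXn primeP Pn.
Qed.

(** * Sufficiency of condition (b) *)

Section ConditionB.
Variable a : nat.
Hypotheses (ha : (0 < a <= d)%N) (hva : v = (U_(xp) *+ a + U_(xn) *+ (d - a))%MM).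
Hypothesis ltv : lex_lt (u - U_(x1) + U_(xn))%MM v.

Lemma v_x1_B : v x1 = 0%N.
Proof. by rewrite hva !(mnmDE, mulmnE, mnm1E) -!val_eqE /=; lia. Qed.

(** All variables but x_n kill the class of x_(n-1)^(a-1) x_n^d: x_1 through x_1 x_n^(d-1), the
    others through x_i x_(n-1)^(a-1) x_n^(d-a) >= v. Its divisors of degree d are all below v. *)
Lemma depth_le_cond_B r : rsl r -> (r <= 1)%N.
Proof.
have hv1 := v_x1_B.
move/(lexsegment_depth_le (V := [set~ xn]) (m := (U_(xp) *+ a.-1 + U_(xn) *+ d)%MM)).
rewrite setCK cards1; apply=> [i|].
  rewrite !inE => ni; have [->|n1] := eqVneq i x1.
    by apply: x1xn_in => //; rewrite !(mnmDE, mulmnE, mnm1E) -!val_eqE /=; lia.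
  apply: (@lexsegment_multiple _ _ _ _ _
    (U_(xp) *+ a.-1 + U_(xn) *+ (d - a) + U_(i))%MM); last first.
    by apply/mnm_lepP => j; rewrite !(mnmDE, mulmnE, mnm1E); lia.
  apply: lexsegmentI.
  - by rewrite !(mdegD, mdegMn, mdeg1); lia.
  - apply/lex_ltW/lex_lt_first; move: huv; rewrite hv1 => ?.
    by rewrite !(mnmDE, mulmnE, mnm1E) (negPf n1) -!val_eqE /=; lia.
  - have -> : v = (U_(xp) *+ a.-1 + U_(xn) *+ (d - a) + U_(xp))%MM.
      by rewrite hva; apply/mnmP => j; rewrite !(mnmDE, mulmnE, mnm1E); lia.
    apply: lex_le_addU; rewrite /= -ltnS; move: ni; rewrite -val_eqE /=.
    by have := ltn_ord i; lia.
case=> w /and3P[/eqP wd _ vw] /mnm_lepP wm.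
move: vw; rewrite lex_leNgt => /negP; apply; apply/lex_ltP; exists xp.
split=> [i /= ltip|]; last first.
  by apply: leq_ltn_trans (wm xp) _; rewrite hva !(mnmDE, mulmnE, mnm1E) -!val_eqE /=; lia.
have := wm i; rewrite hva !(mnmDE, mulmnE, mnm1E) -!val_eqE /=; lia.
Qed.

(** Every prime contains x_2, ..., x_(n-1), whose d-th powers are generators, and one of x_1,
    x_n. *)
Lemma krull_le_cond_B r : prime_chain (quot_alg I) r -> (r <= 1)%N.
Proof.
have hv1 := v_x1_B.
apply: krull_dim_le => P primeP.
have Pi i : i != x1 -> i != xn -> P (quot_alg_pi I 'X_i).
  rewrite -!val_eqE /= => n1 nn; have := ltn_ord i => ltiN.
  apply: (lexsegment_prime_var (e := d)) => //.
  apply: lexsegmentI; first by rewrite mdegMn mdeg1 mul1n.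
    by apply/lex_ltW/lex_lt_first; move: huv; rewrite hv1 !(mnmDE, mulmnE, mnm1E) -!val_eqE /=; lia.
  rewrite lex_leNgt; apply/negP => /lex_ltP[j [eqj]]; have := eqj i.
  rewrite hva !(mnmDE, mulmnE, mnm1E) -!val_eqE /= eqxx.
  by have := ltn_ord j; lia.
have [P1|Pn] := prime_x1_or_xn hv1 primeP.
  exists [set~ xn]; first by rewrite setCK cards1.
  by move=> i; rewrite !inE => ni; have [->//|n1] := eqVneq i x1; apply: Pi.
exists [set~ x1]; first by rewrite setCK cards1.
by move=> i; rewrite !inE => n1; have [->//|nn] := eqVneq i xn; apply: Pi.
Qed.

Lemma cohen_macaulay_cond_B :
  krull_dim_ge (quot_alg I) 1 -> cohen_macaulay_ideal I.
Proof.
case=> s s1 chain_s; exists 1%N; split; split.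
- exact: regular_sum v_x1_B ltv.
- exact: depth_le_cond_B.
- by have -> : 1%N = s by have := krull_le_cond_B chain_s; lia.
- exact: krull_le_cond_B.
Qed.

End ConditionB.

(** * Sufficiency of condition (a) *)

Section ConditionA.
Hypotheses (hua : u = (U_(x1) + U_(xn) *+ d.-1)%MM) (hva : v = (U_(x2) *+ d)%MM).

Lemma v_x1_A : v x1 = 0%N.
Proof. by rewrite hva mulmnE mnm1E. Qed.

Lemma u_x1_A : u x1 = 1%N.
Proof. by rewrite hua !(mnmDE, mulmnE, mnm1E) -!val_eqE /=. Qed.

(** In degree d, x_1 x_n^(d-1) is the immediate successor of x_2^d, so [u] and [v] are the only
    generators. *)
Lemma multiple_of_A m :
  multiple_of L m <-> ((0 < m x1)%N /\ (d.-1 <= m xn)%N) \/ (d <= m x2)%N.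
Proof.
split=> [[w /and3P[/eqP wd wu vw] /mnm_lepP wm]|[[m1 mn]|m2]].
- have [w10|w1p] := posnP (w x1); [right|left].
    apply: leq_trans (wm x2); rewrite leqNgt; apply/negP => w2.
    move: vw; rewrite lex_leNgt => /negP; apply; apply/lex_ltP; exists x2; split=> [i|].
      rewrite ltnS leqn0 => /eqP i0; have -> : i = x1 by apply: val_inj.
      by rewrite w10 v_x1_A.
    by rewrite hva mulmnE mnm1E eqxx mul1n.
  suff E : w = u.
    by move: (wm x1) (wm xn); rewrite E hua !(mnmDE, mulmnE, mnm1E) -!val_eqE /=; lia.
  apply: lex_le_anti wu _.
  apply: lex_le_except_last => [|i ni]; first by rewrite hu wd.
  rewrite hua !(mnmDE, mulmnE, mnm1E) [xn == i]eq_sym (negPf ni).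
  by case: eqP => [<-|]; lia.
- exact: x1xn_in v_x1_A m1 mn.
apply: (@lexsegment_multiple _ _ _ _ _ v).
  by apply: lexsegmentI => //; [apply/lex_ltW/lex_lt_first|apply: lexx].
by apply/mnm_lepP => i; rewrite hva mulmnE mnm1E; case: eqP => [<-|]; lia.
Qed.

(** Both x_1 and x_2 kill the class of x_2^(d-1) x_n^(d-1). *)
Lemma depth_le_cond_A r : rsl r -> (r <= N.+1)%N.
Proof.
move/(lexsegment_depth_le (V := [set i : 'I_N.+3 | (i <= x2)%N])
  (m := (U_(x2) *+ d.-1 + U_(xn) *+ d.-1)%MM)).
rewrite card_initial /= subn1; apply=> [i|].
  rewrite inE /= => lei; apply/multiple_of_A.
  have [i0|i0] := posnP i.
    have -> : i = x1 by apply: val_inj.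
    by left; rewrite !(mnmDE, mulmnE, mnm1E) -!val_eqE /=; lia.
  have -> : i = x2 by apply: val_inj => /=; lia.
  by right; rewrite !(mnmDE, mulmnE, mnm1E) -!val_eqE /=; lia.
by move/multiple_of_A; rewrite !(mnmDE, mulmnE, mnm1E) -!val_eqE /=; lia.
Qed.

Lemma krull_le_cond_A r : prime_chain (quot_alg I) r -> (r <= N.+1)%N.
Proof.
apply: krull_dim_le => P primeP.
have P2 : P (quot_alg_pi I 'X_x2).
  apply: (lexsegment_prime_var (e := d)) => //; rewrite -hva.
  by apply: lexsegmentI => //; [apply/lex_ltW/lex_lt_first|apply: lexx].
have card2 i : i != x2 -> (#|~: [set i; x2]| <= N.+1)%N.
  move=> n2; have := cardsC [set i; x2]; rewrite card_ord cards2 n2; lia.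
have [P1|Pn] := prime_x1_or_xn v_x1_A primeP.
  by exists [set x1; x2]; rewrite ?card2 // => i; rewrite !inE => /orP[]/eqP->.
by exists [set xn; x2]; rewrite ?card2 // => i; rewrite !inE => /orP[]/eqP->.
Qed.

Lemma regular_cond_A : rsl N.+1.
Proof.
(* The variables x_3, ..., x_(n-1); none when n = 3. *)
pose s : seq 'I_N.+3 := map inord (iota 2 N).
have sP i : i \in s -> (1 < i)%N /\ (i < N.+2)%N.
  case/mapP=> j; rewrite mem_iota => jN ->; rewrite inordK; lia.
have us : uniq s.
  rewrite map_inj_in_uniq ?iota_uniq // => i j; rewrite !mem_iota => iN jN.
  by move/(congr1 val); rewrite /= !inordK //; lia.
have sN : size s = N by rewrite size_map size_iota.
suff : rsl (size s).+1 by rewrite sN.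
apply: (regular_seq_vars_sum (a := x1) (b := xn) (@lexsegment_idealP k _ d u v)) => //.
- exact: not_multiple0.
- by move=> m i; apply: multiple_ofD.
- move=> i m /sP[i1 iN]; rewrite !multiple_of_A !(mnmDE, mulmnE, mnm1E) -!val_eqE /=; lia.
- by apply/negP => /sP[].
- by apply/negP => /sP[_]; rewrite /= ltnn.
- by move=> m; apply: x1_square u_x1_A.
move=> m _; rewrite !multiple_of_A !(mnmDE, mulmnE, mnm1E) -!val_eqE /=; lia.
Qed.

Lemma cohen_macaulay_cond_A : cohen_macaulay_ideal I.
Proof.
exists N.+1; split; split.
- exact: regular_cond_A.
- exact: depth_le_cond_A.
- change (prime_chain (quot_alg I) (N.+3 - 2)).
  apply: lexsegment_prime_chain => // w Lw.
  have /multiple_of_A[[w1 _]|w2] : multiple_of L w by exists w => //; apply: lepm_refl.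
    by exists x1.
  by exists x2 => //; lia.
- exact: krull_le_cond_A.
Qed.

End ConditionA.

(** * Necessity of the two conditions *)

Lemma cohen_macaulay_cond : krull_dim_ge (quot_alg I) 1 -> cohen_macaulay_ideal I ->
  (u = (U_(x1) + U_(xn) *+ d.-1)%MM /\ v = (U_(x2) *+ d)%MM) \/
  exists a : nat, [/\ (0 < a <= d)%N, v = (U_(xp) *+ a + U_(xn) *+ (d - a))%MM
    & lex_lt (u - U_(x1) + U_(xn))%MM v].
Proof.
case=> s s1 chain_s [r [[rslr _] [_ /[dup] dim_ge /(_ s chain_s) ltsr]]].
have [/depth_le_socle/(_ rslr)|] := boolP (lex_le v (u - U_(x1) + U_(xn))%MM); first by lia.
rewrite lex_leNgt negbK => ltv; have hu1 := u_x1 ltv.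
(* If b > 0, every generator is divisible by x_1, so the dimension is at least n - 1. *)
have dim1 : (0 < v x1)%N -> (N.+2 <= r)%N.
  move=> v1; apply: dim_ge; change (prime_chain (quot_alg I) (N.+3 - 1)).
  apply: lexsegment_prime_chain => // w /and3P[_ _ /lex_le_first vw].
  by exists x1 => //; apply: leq_trans vw.
have [/depth_le_one/(_ rslr) r1|] := boolP (lex_le v (p xn)).
  right; have hv1 : v x1 = 0%N by have := dim1; lia.
  (* Otherwise every w >= v involves one of x_1, ..., x_(n-2), which gives a chain of length 2,
     while the depth is at most 1. *)
  have v0 (i : 'I_N.+3) : (i < N.+1)%N -> v i = 0%N.
    move=> ltiN; apply/eqP; rewrite -leqn0 leqNgt; apply/negP => vi.
    suff /dim_ge : prime_chain (quot_alg I) (N.+3 - N.+1) by lia.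
    apply: lexsegment_prime_chain => [|w /and3P[_ _ vw]]; first by lia.
    apply: contrapT => now; move: vw; rewrite lex_leNgt => /negP; apply.
    have w0 (j : 'I_N.+3) : (j < N.+1)%N -> w j = 0%N.
      by move=> jN; apply/eqP; rewrite -leqn0 leqNgt; apply/negP => ?; apply: now; exists j.
    have exv : exists j : nat, (j < N.+1)%N && (0 < v (inord j))%N.
      by exists i; rewrite ltiN inord_val.
    case: (ex_minnP exv) => j /andP[jN vj] jmin.
    apply/lex_ltP; exists (inord j); split=> [l|]; last by rewrite w0 // inordK //; lia.
    rewrite inordK => [ltlj|]; last by lia.
    rewrite w0; last by lia.
    apply/esym/eqP; rewrite -leqn0 leqNgt; apply/negP => vl.
    have := jmin l; rewrite inord_val vl andbT; lia.
  have vE : v = (U_(xp) *+ v xp + U_(xn) *+ v xn)%MM.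
    apply/mnmP => i; rewrite !(mnmDE, mulmnE, mnm1E).
    have [<-|np] := eqVneq xp i; first by rewrite -val_eqE /=; lia.
    have [<-|nn] := eqVneq xn i; first by lia.
    by rewrite v0 //; move: np nn; rewrite -!val_eqE /=; have := ltn_ord i; lia.
  have dE : d = (v xp + v xn)%N by rewrite -hv [in LHS]vE mdegD !mdegMn !mdeg1 !mul1n.
  exists (v xp); split=> //; last by rewrite [LHS]vE; congr (_ + _ *+ _)%MM; lia.
  apply/andP; split; last by lia.
  (* Without x_(n-1), [v] = x_n^d would be the least monomial of degree d, against [ltv]. *)
  rewrite lt0n; apply: contraTneq ltv => vp0; rewrite -lex_leNgt.
  apply: lex_le_except_last => [|i ni].
    by rewrite hv mdegD mdeg1 -hu -[in LHS]subm_x1K mdegD mdeg1.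
  by rewrite vE vp0 !(mnmDE, mulmnE, mnm1E) [xn == i]eq_sym (negPf ni); lia.
rewrite lex_leNgt negbK => /v_eq_p[j [j0 jN vE]].
have rj := depth_le_initial hu1 j0 jN vE rslr.
have hv1 : v x1 = 0%N by have := dim1; lia.
rewrite hv1 in hu1.
have dim2 : (N.+1 <= r)%N.
  apply: dim_ge; change (prime_chain (quot_alg I) (N.+3 - 2)).
  apply: lexsegment_prime_chain => // w /and3P[_ _ vw].
  have [w1|w1] := posnP (w x1); last by exists x1.
  exists x2 => //; rewrite lt0n; apply: contraTneq vw => w2.
  rewrite lex_leNgt negbK; apply/lex_ltP; exists x2; split=> [i|].
    rewrite ltnS leqn0 => /eqP i0; have -> : i = x1 by apply: val_inj.
    by rewrite w1 hv1.
  by rewrite w2 vE /p hv1 !(mnmDE, mulmnE, mnm1E) -!val_eqE /=; lia.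
(* The bounds N + 1 <= r <= N + 2 - j leave only j = 1, the position of x_2. *)
have jE : j = x2 by apply: val_inj => /=; lia.
have {}vE : v = (U_(x2) *+ d)%MM.
  rewrite vE jE /p hv1; apply/mnmP => i.
  by rewrite !(mnmDE, mulmnE, mnm1E) subn0; case: eqP; lia.
(* For n = 3, x_2 is x_(n-1) and condition (b) holds with a = d; for n >= 4 any other [u] would have
   depth at most n - 3. *)
have [N0|N0] := posnP N.
  right; exists d; split=> //; first by lia.
  rewrite [LHS]vE subnn mulm0n addm0; congr (U_(_) *+ _)%MM.
  by apply: val_inj; rewrite /= N0.
left; split=> //; apply: contrapT => neu.
by have := depth_le_codim3 N0 hu1 vE neu rslr; lia.
Qed.

End Combinatorics.

Theorem theorem2p3p9 (k : fieldType) (n d : nat)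
    (hn : (3 <= n)%N) (hd : (2 <= d)%N) (u v : 'X_{1..n})
    (hu : mdeg u = d) (hv : mdeg v = d)
    (huv : (mon_exp v 1 < mon_exp u 1)%N)
    (hdim : krull_dim_ge (quot_alg (lexsegment_ideal k d u v)) 1) :
  cohen_macaulay_ideal (lexsegment_ideal k d u v) <->
    (u = (mon_var n 1 + mon_var n n *+ (d - 1))%MM /\
     v = (mon_var n 2 *+ d)%MM)
    \/
    (exists a : nat,
       [/\ (0 < a <= d)%N,
           v = (mon_var n n.-1 *+ a + mon_var n n *+ (d - a))%MM
         & lex_lt (u + mon_var n n - mon_var n 1)%MM v]).
Proof.
case: n hn u v hu hv huv hdim => [|[|[|N]]] // _ u v hu hv huv hdim.
rewrite !(mon_expE _ ord0) in huv.
rewrite (mon_varE ord0) (mon_varE (@ord_max N.+2)) (mon_varE (Ordinal (isT : (1 < N.+3)%N))).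
rewrite (mon_varE (Ordinal (leqnSn N.+2))) subn1.
(* Exponent subtraction is truncated; the two orders agree because x_1 divides u. *)
have -> : (u + U_(ord_max) - U_(ord0) = u - U_(ord0) + U_(ord_max))%MM.
  by rewrite -{1}(subm_x1K huv) -addmA [(U_(_) + U_(_))%MM]addmC addmA addmK.
split=> [|[[hua hva]|[a [ha hva ltv]]]].
- exact: cohen_macaulay_cond.
- exact: cohen_macaulay_cond_A.
- exact: cohen_macaulay_cond_B ha hva ltv hdim.
Qed.
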